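(* Let $\mathbb{K}$ be a field and let $\eta_{\mathrm{ParQSym}}=\eta\circ\Psi_{PQ}:\mathrm{ParQSym}\to\mathbb{K}$. Then $(\mathrm{ParQSym},\eta_{\mathrm{ParQSym}})$ is an infinitorial Hopf algebra.
   Context: An infinitesimal character of a Hopf algebra $H$ over $\mathbb{K}$ is a linear map $\xi:H\to\mathbb{K}$ with $\xi(ab)=\varepsilon(a)\xi(b)+\xi(a)\varepsilon(b)$ for all $a,b\in H$. An infinitorial Hopf algebra is a pair $(H,\xi)$ with $H$ a connected graded Hopf algebra and $\xi$ an infinitesimal character of $H$. **Partition diagrams.** A partition diagram of order $k\ge 0$ is a set partition of $\{1,\dots,k,1',\dots,k'\}$; for $k=0$ the only one is the empty diagram $\emptyset$. For $\pi$ of order $k$ and $\rho$ of order $m$, $\pi\otimes\rho$ is the diagram of order $k+m$ whose blocks are the blocks of $\pi$ and the blocks of $\rho$ with labels shifted by $k$ ($i\mapsto i+k$, $i'\mapsto (i+k)'$). If $k,m\ge1$, $\pi\bullet\rho$ is obtained from $\pi\otimes\rho$ by merging the block containing $k'$ with the block containing $(k+1)'$. The empty diagram is the unit for both operations. A diagram is $\otimes$-irreducible if it is not $\rho\otimes\sigma$ with $\rho,\sigma$ both non-empty. Every non-empty $\pi$ is uniquely $\pi_1\otimes\cdots\otimes\pi_l$ with all $\pi_i$ non-empty and $\otimes$-irreducible. **ParQSym.** $\mathrm{ParQSym}=\bigoplus_{i\ge0}\mathrm{ParQSym}_i$, where $\mathrm{ParQSym}_i$ has $\mathbb{K}$-basis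 $\{M_\pi:\pi\text{ of order }i\}$. Coproduct: $\Delta M_\sigma=\sum_{\pi\otimes\rho=\sigma}M_\pi\otimes M_\rho$. Counit: $\varepsilon(M_\pi)=\delta_{\pi,\emptyset}$. Product: $M_\emptyset$ is the unit; for non-empty $\rho=\rho_1\otimes\cdots\otimes\rho_n$, $\sigma=\sigma_1\otimes\cdots\otimes\sigma_m$ with all $\rho_i,\sigma_j$ non-empty $\otimes$-irreducible, $$M_\rho\star M_\sigma=\sum M_{(\rho'_1\bullet\sigma'_1)\otimes\cdots\otimes(\rho'_k\bullet\sigma'_k)},$$ over all $k\in\mathbb{N}$ and all pairs of sequences of diagrams $(\rho'_1,\dots,\rho'_k)$, $(\sigma'_1,\dots,\sigma'_k)$ that become $(\rho_1,\dots,\rho_n)$, respectively $(\sigma_1,\dots,\sigma_m)$, after deleting all empty diagrams, and such that $\rho'_s\bullet\sigma'_s\ne\emptyset$ for all $1\le s\le k$. **Maps.** $\mathrm{QSym}$ is the Hopf algebra of quasisymmetric functions over $\mathbb{K}$ with monomial basis $M_\alpha=\sum_{i_1<\cdots<i_p}x_{i_1}^{\alpha_1}\cdots x_{i_p}^{\alpha_p}$ indexed by compositions $\alpha=(\alpha_1,\dots,\alpha_p)$ (including the empty composition $()$). $\Psi_{PQ}:\mathrm{ParQSym}\to\mathrm{QSym}$ is the linear map with $\Psi_{PQ}(M_\emptyset)=M_{()}$ and, for non-empty $\rho=\rho_1\otimes\cdots\otimes\rho_n$ with $\rho_i$ non-empty $\otimes$-irreducible of order $\alpha_i$, $\Psi_{PQ}(M_\rho)=M_{(\alpha_1,\dots,\alpha_n)}$.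 $\eta:\mathrm{QSym}\to\mathbb{K}$ is the linear map $\eta(M_\alpha)=(-1)^{l(\alpha)-1}\,lp(\alpha)$, where $l(\alpha)$ is the number of parts, $lp(\alpha)$ is the last part of $\alpha$, and $lp(())=0$. *)

(* Defs.v *)
From HB Require Import structures.
From mathcomp Require Import all_boot all_order all_algebra.
From mathcomp Require Import sesquilinear generic_quotient ring_quotient.
From mathcomp Require Import finmap.
From mathcomp Require Import all_classical.
From mathcomp Require Import multinomials.monalg.

Set Implicit Arguments.
Unset Strict Implicit.
Unset Printing Implicit Defensive.

Import GRing.Theory.

Local Open Scope classical_set_scope.
Local Open Scope ring_scope.
Local Open Scope quotient_scope.

Section LinearSpan.
Variables (K : fieldType) (W : lmodType K).

Definition lspan (S : set W) : set W :=
  [set x | exists n (c : 'I_n -> K) (s : 'I_n -> W),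
    (forall i, S (s i)) /\ x = \sum_(i < n) c i *: s i].

Definition subspace (A : set W) : Prop :=
  A 0 /\ (forall a x y, A x -> A y -> A (a *: x + y)).

Lemma lspan_subspace (S : set W) : subspace (lspan S).
Proof.
split; first by exists 0, (fun=> 0), (fun=> 0); split=> [[]|]; rewrite ?big_ord0.
move=> a x y [n [c [s [Ss ->]]]] [m [d [t [St ->]]]].
exists (n + m)%N,
  (fun i : 'I_(n + m) =>
     match fintype.split i with inl j => a * c j | inr j => d j end),
  (fun i : 'I_(n + m) => match fintype.split i with inl j => s j | inr j => t j end);
  split.
  by move=> i; case: (fintype.split i).
rewrite big_split_ord scaler_sumr /=; congr (_ + _); apply: eq_bigr => i _.
  by rewrite -[lshift m i]/(unsplit (inl i)) unsplitK scalerA.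
by rewrite -[rshift n i]/(unsplit (inr i)) unsplitK.
Qed.

Lemma sub_lspan (S : set W) x : S x -> lspan S x.
Proof.
by move=> Sx; exists 1%N, (fun=> 1), (fun=> x); rewrite big_ord1 scale1r.
Qed.

Lemma lspan_min (S A : set W) : subspace A -> S `<=` A -> lspan S `<=` A.
Proof.
move=> [A0 AD] SA _ [n [c [s [Ss ->]]]].
apply: (big_ind A) => // [x y Ax Ay|i _].
  by rewrite -[x]scale1r; apply: AD.
by rewrite -[_ *: _]addr0; apply: AD => //; apply/SA/Ss.
Qed.

End LinearSpan.

Section LinearExtension.
Variables (K : fieldType) (B : choiceType) (W : lmodType K).

Definition lin_ext (f : B -> W) (x : {malg K[B]}) : W :=
  \sum_(b <- msupp x) x@_b *: f b.

Lemma lin_extEw f (x : {malg K[B]}) (D : {fset B}) : (msupp x `<=` D)%fset ->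
  lin_ext f x = \sum_(b <- D) x@_b *: f b.
Proof.
move=> sxD; rewrite /lin_ext (big_fset_incl _ sxD) // => b _ /mcoeff_outdom ->.
by rewrite scale0r.
Qed.

Fact lin_ext_linear f : linear (lin_ext f).
Proof.
move=> a x y; set D := (msupp x `|` msupp y)%fset.
have sx : (msupp x `<=` D)%fset by apply: fsubsetUl.
have sy : (msupp y `<=` D)%fset by apply: fsubsetUr.
have sz : (msupp (a *: x + y) `<=` D)%fset.
  apply: (fsubset_trans (msuppD_le _ _)); apply: fsetSU; exact: msuppZ_le.
rewrite (lin_extEw f sx) (lin_extEw f sy) (lin_extEw f sz) scaler_sumr -big_split.
by apply: eq_bigr => b _; rewrite mcoeffD mcoeffZ scalerDl scalerA.
Qed.

HB.instance Definition _ f :=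
  GRing.isLinear.Build K {malg K[B]} W _ (lin_ext f) (lin_ext_linear f).

Lemma lin_ext_basis f b : lin_ext f << b >> = f b.
Proof.
by rewrite (lin_extEw f msuppU_le) big_seq_fset1 mcoeffUU scale1r.
Qed.

End LinearExtension.

Section Tensor.
Variables (K : fieldType) (U V : lmodType K).

Definition tensor_rel : set {malg K[(U * V)%type]} :=
  [set r | (exists a u u' v,
              r = << (a *: u + u', v) >> - (a *: << (u, v) >> + << (u', v) >>)) \/
           (exists a u v v',
              r = << (u, a *: v + v') >> - (a *: << (u, v) >> + << (u, v') >>))].

Definition tensor_ker : {pred {malg K[(U * V)%type]}} :=
  fun x => `[< lspan tensor_rel x >].

Fact tensor_ker_submod : submod_closed tensor_ker.
Proof.
have [h0 hD] := lspan_subspace tensor_rel.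
split; first exact/asboolP.
by move=> a x y /asboolP hx /asboolP hy; apply/asboolP/hD.
Qed.

HB.instance Definition _ :=
  GRing.isSubmodClosed.Build K {malg K[(U * V)%type]} tensor_ker tensor_ker_submod.

Definition tensor := Quotient.quot tensor_ker.

HB.instance Definition _ := GRing.Zmodule.on tensor.
HB.instance Definition _ := EqQuotient.on tensor.

Lemma tensor_eqP (x y : {malg K[(U * V)%type]}) :
  reflect (\pi_tensor x = \pi_tensor y) (x - y \in tensor_ker).
Proof. by rewrite Quotient.idealrBE; exact: eqP. Qed.

Definition tensor_scale (a : K) (x : tensor) : tensor :=
  \pi_tensor (a *: repr x).

Lemma tensor_scaleE a x : tensor_scale a (\pi_tensor x) = \pi_tensor (a *: x).
Proof.
apply/tensor_eqP; rewrite -scalerBr; apply: rpredZ; apply/tensor_eqP.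
by rewrite reprK.
Qed.

Fact tensor_scaleA a b x :
  tensor_scale a (tensor_scale b x) = tensor_scale (a * b) x.
Proof.
by rewrite -[x]reprK (tensor_scaleE b) (tensor_scaleE a) tensor_scaleE scalerA.
Qed.

Fact tensor_scale1 : left_id 1 tensor_scale.
Proof. by move=> x; rewrite -[x in LHS]reprK tensor_scaleE scale1r reprK. Qed.

Fact tensor_scaleDr : right_distributive tensor_scale +%R.
Proof.
move=> a x y; rewrite -[x]reprK -[y]reprK -raddfD /=.
by rewrite !tensor_scaleE scalerDr raddfD.
Qed.

Fact tensor_scaleDl x : {morph tensor_scale^~ x : a b / a + b}.
Proof.
by move=> a b; rewrite -[x]reprK !tensor_scaleE scalerDl raddfD.
Qed.

HB.instance Definition _ := GRing.Zmodule_isLmodule.Build K tensor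
  tensor_scaleA tensor_scale1 tensor_scaleDr tensor_scaleDl.

Lemma tensor_piZ a x : \pi_tensor (a *: x) = a *: \pi_tensor x :> tensor.
Proof. by rewrite -tensor_scaleE. Qed.

Fact tensor_pi_linear : linear (\pi_tensor : {malg K[(U * V)%type]} -> tensor).
Proof. by move=> a x y; rewrite raddfD /= tensor_piZ. Qed.

Definition tpure (u : U) (v : V) : tensor := \pi_tensor << (u, v) >>.

Lemma tpure_bilinear : bilinear_for *:%R *:%R tpure.
Proof.
split=> [v a u u'|u a v v']; rewrite /tpure -tensor_pi_linear;
  apply/tensor_eqP/asboolP/sub_lspan; [left|right].
- by exists a, u, u', v.
- by exists a, u, v, v'.
Qed.

Lemma tensor_pureE (x : tensor) :
  exists n (u : 'I_n -> U) (v : 'I_n -> V), x = \sum_(i < n) tpure (u i) (v i).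
Proof.
rewrite -[x]reprK; set y := repr x.
pose s := enum_fset (msupp y).
exists (size s), (fun i => y@_(tnth (in_tuple s) i) *: (tnth (in_tuple s) i).1),
  (fun i => (tnth (in_tuple s) i).2).
rewrite {1}[y]monalgE raddf_sum /=.
rewrite (big_tnth _ _ s) /=; apply: eq_bigr => i _.
have tZ a u v : tpure (a *: u) v = a *: tpure u v.
  have t0 : tpure 0 v = 0.
    have := (tpure_bilinear.1 v) (-1) u u.
    by rewrite /= !scaleN1r !addNr.
  by have := (tpure_bilinear.1 v) a u 0; rewrite t0 !addr0.
rewrite tZ /tpure -surjective_pairing -tensor_piZ.
congr (\pi_tensor _); apply/malgP => k.
by rewrite mcoeffZ !mcoeffU mulr_natr.
Qed.

Section Lift.
Variable W : lmodType K.

(* The linear map induced by f; meaningful when f is bilinear. *)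
Definition tlift (f : U -> V -> W) (x : tensor) : W :=
  lin_ext (fun p => f p.1 p.2) (repr x).

Variable f : U -> V -> W.
Hypothesis f_bil : bilinear_for *:%R *:%R f.

Lemma tlift_pi x : tlift f (\pi_tensor x) = lin_ext (fun p => f p.1 p.2) x.
Proof.
rewrite /tlift; set g := lin_ext _; apply/eqP; rewrite -subr_eq0 -raddfB /=.
have : repr (\pi_tensor x) - x \in tensor_ker by apply/tensor_eqP; rewrite reprK.
have g_ker : lspan (@tensor_rel) `<=` [set y | g y = 0].
  apply: lspan_min; first split=> [|a y z /= gy gz].
  - by rewrite /= /g raddf0.
  - rewrite /=; transitivity (a *: g y + g z); first exact: lin_ext_linear.
    by rewrite gy gz scaler0 addr0.
  move=> r /= [] [a [u [v [w ->]]]];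
    rewrite /= /g raddfB raddfD /= linearZ /= !lin_ext_basis /=.
  + by rewrite (f_bil.1 w) subrr.
  + by rewrite (f_bil.2 u) subrr.
by move=> /asboolP/g_ker/eqP.
Qed.

Lemma tlift_linear : linear (tlift f).
Proof.
move=> a x y; rewrite -[x]reprK -[y]reprK -tensor_pi_linear !tlift_pi.
by rewrite linearP.
Qed.

Lemma tlift_pure u v : tlift f (tpure u v) = f u v.
Proof. by rewrite tlift_pi lin_ext_basis. Qed.

End Lift.
End Tensor.

Notation "u \ox v" := (tpure u v) (at level 40, left associativity).

Definition tmap (K : fieldType) (U U' V V' : lmodType K)
    (f : U -> U') (g : V -> V') : tensor U V -> tensor U' V' :=
  tlift (fun u v => f u \ox g v).

Definition tassoc (K : fieldType) (U V W : lmodType K) :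
    tensor (tensor U V) W -> tensor U (tensor V W) :=
  tlift (fun t w => tlift (fun u v => u \ox (v \ox w)) t).

Definition tmul (K : fieldType) (H : lmodType K) (mul : H -> H -> H)
    (x y : tensor H H) : tensor H H :=
  tlift (fun a b => tlift (fun c d => mul a c \ox mul b d) y) x.

Section HopfAlgebras.
Variables (K : fieldType) (H : lmodType K).

Record graded_bialgebra_data := GradedBialgebraData {
  hmul : H -> H -> H;
  hone : H;
  hcomul : H -> tensor H H;
  hcounit : H -> K;
  hdeg : nat -> set H
}.

Definition is_algebra (mul : H -> H -> H) (one : H) : Prop :=
  [/\ bilinear_for *:%R *:%R mul, associative mul,
      left_id one mul & right_id one mul].

Definition is_coalgebra (comul : H -> tensor H H) (counit : H -> K) : Prop :=
  [/\ linear comul, scalar counit,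
      forall x, tassoc (tmap comul id (comul x)) = tmap id comul (comul x),
      forall x, tlift (fun a b => counit a *: b) (comul x) = x &
      forall x, tlift (fun a b => counit b *: a) (comul x) = x].

Variable D : graded_bialgebra_data.
Local Notation "x ** y" := (hmul D x y) (at level 40, left associativity).
Local Notation one := (hone D).
Local Notation comul := (hcomul D).
Local Notation counit := (hcounit D).
Local Notation deg := (hdeg D).

Definition is_bialgebra : Prop :=
  [/\ is_algebra (hmul D) one, is_coalgebra comul counit,
      comul one = one \ox one /\
        (forall x y, comul (x ** y) = tmul (hmul D) (comul x) (comul y)) &
      counit one = 1 /\ (forall x y, counit (x ** y) = counit x * counit y)].

Definition is_antipode (S : H -> H) : Prop :=
  [/\ linear S,
      forall x, tlift (fun a b => S a ** b) (comul x) = counit x *: one &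
      forall x, tlift (fun a b => a ** S b) (comul x) = counit x *: one].

Definition is_direct_sum : Prop :=
  [/\ forall n, subspace (deg n),
      forall x, exists n (c : nat -> H),
        (forall i, deg i (c i)) /\ x = \sum_(i < n) c i &
      forall n (c : nat -> H), (forall i, deg i (c i)) ->
        \sum_(i < n) c i = 0 -> forall i, (i < n)%N -> c i = 0].

Definition tensor_deg (n : nat) : set (tensor H H) :=
  lspan [set t | exists i j x y,
    [/\ (i + j = n)%N, deg i x, deg j y & t = x \ox y]].

Definition is_graded_bialgebra : Prop :=
  [/\ is_bialgebra, is_direct_sum,
      deg 0%N one /\ (forall i j x y, deg i x -> deg j y -> deg (i + j)%N (x ** y)),
      forall n x, deg n x -> tensor_deg n (comul x) &
      forall n x, (0 < n)%N -> deg n x -> counit x = 0].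

Definition is_graded_hopf_algebra : Prop :=
  is_graded_bialgebra /\
  exists S, is_antipode S /\ (forall n x, deg n x -> deg n (S x)).

Definition is_connected : Prop :=
  deg 0%N = [set x | exists c : K, x = c *: one].

Definition infinitesimal_character (xi : H -> K) : Prop :=
  scalar xi /\
  (forall a b, xi (a ** b) = counit a * xi b + xi a * counit b).

Definition infinitorial_hopf_algebra (xi : H -> K) : Prop :=
  [/\ is_graded_hopf_algebra, is_connected & infinitesimal_character xi].

End HopfAlgebras.

(* The vertex (i, false) stands for the label i, and (i, true) for i'. *)
Definition vertices (k : nat) : {fset nat * bool} :=
  [fset v in [seq (i, b) | i <- iota 1 k, b <- [:: false; true]]]%fset.

Definition is_diagram (p : nat * {fset {fset nat * bool}}) : bool :=
  [&& fcover p.2 == vertices p.1, trivIfset p.2 & fset0 \notin p.2].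

Record diagram := Diagram {
  diagram_val :> nat * {fset {fset nat * bool}};
  _ : is_diagram diagram_val
}.

HB.instance Definition _ := [isSub for diagram_val].
HB.instance Definition _ := [Choice of diagram by <:].

Definition diag_order (p : diagram) : nat := (val p).1.
Definition blocks (p : diagram) : {fset {fset nat * bool}} := (val p).2.

Lemma in_vertices k v : (v \in vertices k) = (0 < v.1 <= k)%N.
Proof.
case: v => i b; rewrite inE; apply/allpairsP/idP => [[[j c]]|/= ik].
  by rewrite mem_iota /= => -[/andP[j0 jk] _ [-> _]]; rewrite j0 -ltnS -add1n.
by exists (i, b); rewrite mem_iota add1n ltnS ik !inE /=; case: b.
Qed.

Lemma fcoverP (T : choiceType) (P : {fset {fset T}}) x :
  reflect (exists2 A, A \in P & x \in A) (x \in fcover P).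
Proof.
rewrite /fcover; apply: (iffP (bigfcupP _ _ _ _)) => [[A]|[A AP xA]]; first by rewrite andbT; exists A.
by exists A; rewrite ?AP.
Qed.

Lemma is_diagramP k (P : {fset {fset nat * bool}}) :
  reflect
    [/\ forall v, (0 < v.1 <= k)%N <-> (exists2 A, A \in P & v \in A),
        forall A B v, A \in P -> B \in P -> v \in A -> v \in B -> A = B &
        forall A, A \in P -> exists v, v \in A]
    (is_diagram (k, P)).
Proof.
apply: (iffP and3P) => /= -[].
  move=> /eqP cP /trivIfsetP tP nP; split.
  - move=> v; rewrite -in_vertices -cP; split=> [/fcoverP //|h].
    exact/fcoverP.
  - move=> A B v AP BP vA vB; apply/eqP/negPn/negP => AB.
    by have /fdisjointP/(_ v vA) := tP A B AP BP AB; rewrite vB.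
  - move=> A AP; have [A0|//] := fset_0Vmem A; last by case=> v; exists v.
    by rewrite A0 (negPf nP) in AP.
move=> cP tP nP; split.
- apply/eqP/fsetP => v; rewrite in_vertices.
  by apply/fcoverP/idP => /cP.
- apply/trivIfsetP => A B AP BP AB; apply/fdisjointP => v vA.
  by apply/negP => vB; rewrite (tP A B v) ?eqxx in AB.
- by apply/negP => /nP[v]; rewrite inE.
Qed.

Fact is_diagram0 : is_diagram (0%N, fset0).
Proof.
apply/is_diagramP; split=> [v|A B v|A]; rewrite ?inE //.
by split=> [|[A]]; rewrite ?inE //; case: v.1.
Qed.

Definition diagram0 : diagram := Diagram is_diagram0.

Definition shift_label (k : nat) (v : nat * bool) : nat * bool := ((v.1 + k)%N, v.2).

Definition shift_block (k : nat) (A : {fset nat * bool}) : {fset nat * bool} :=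
  [fset shift_label k v | v in A]%fset.

Definition otimes_blocks (p q : diagram) : {fset {fset nat * bool}} :=
  (blocks p `|` [fset shift_block (diag_order p) A | A in blocks q])%fset.

Lemma diagram_axioms (p : diagram) : is_diagram (diag_order p, blocks p).
Proof. by case: p => [[k P] hP]. Qed.

Fact is_diagram_otimes p q :
  is_diagram ((diag_order p + diag_order q)%N, otimes_blocks p q).
Proof.
have /is_diagramP[cp tp np] := diagram_axioms p.
have /is_diagramP[cq tq nq] := diagram_axioms q.
have shiftI : injective (shift_label (diag_order p)).
  by move=> [i b] [j c] [/addIn -> ->].
have lo A v : A \in blocks p -> v \in A -> (0 < v.1 <= diag_order p)%N.
  by move=> Ap vA; apply/cp; exists A.
have hi A v : A \in blocks q -> v \in shift_block (diag_order p) A ->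
    exists w, [/\ v = shift_label (diag_order p) w, w \in A & (0 < w.1 <= diag_order q)%N].
  move=> Aq /imfsetP[w /= wA ->]; exists w; split=> //.
  by apply/cq; exists A.
apply/is_diagramP; split.
- move=> v; split=> [/andP[v0 vk]|[A /fsetUP[Ap|/imfsetP[B /= Bq ->]]]].
  + have [vp|vp] := leqP v.1 (diag_order p).
      have [|A Ap vA] := (cp v).1; first by rewrite v0 vp.
      by exists A => //; apply/fsetUP; left.
    pose w := ((v.1 - diag_order p)%N, v.2).
    have [|A Aq wA] := (cq w).1.
      by rewrite /= subn_gt0 vp /= leq_subLR.
    exists (shift_block (diag_order p) A).
      by apply/fsetUP; right; apply/imfsetP; exists A.
    apply/imfsetP; exists w => //; rewrite /shift_label /w /= subnK //; last exact: ltnW.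
    by case: (v).
  + move=> /(lo A v Ap)/andP[-> /= /leq_trans]; apply; exact: leq_addr.
  + move=> /(hi B v Bq)[w [-> _ /andP[w0 wq]]]; rewrite /shift_label /=.
    by rewrite addn_gt0 w0 /= addnC leq_add2l.
- move=> A B v /fsetUP[Ap|/imfsetP[A' /= Aq ->]] /fsetUP[Bp|/imfsetP[B' /= Bq ->]].
  + exact: tp.
  + move=> /(lo A v Ap)/andP[_ vp] /(hi B' v Bq)[w [vE _ /andP[w0 _]]].
    by move: vp; rewrite vE /shift_label /= leqNgt -[X in (X < _)%N]add0n ltn_add2r w0.
  + move=> /(hi A' v Aq)[w [vE _ /andP[w0 _]]] /(lo B v Bp)/andP[_ vp].
    by move: vp; rewrite vE /shift_label /= leqNgt -[X in (X < _)%N]add0n ltn_add2r w0.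
  + move=> /(hi A' v Aq)[w [vE wA _]] /(hi B' v Bq)[w' [vE' wB _]].
    have /shiftI ww : shift_label (diag_order p) w = shift_label (diag_order p) w' by rewrite -vE.
    by rewrite (tq A' B' w) // ww.
- move=> A /fsetUP[/np //|/imfsetP[B /= /nq [v vB] ->]].
  by exists (shift_label (diag_order p) v); apply/imfsetP; exists v.
Qed.

Definition otimes (p q : diagram) : diagram := Diagram (is_diagram_otimes p q).

(* Replaces the blocks containing v or w by their union. *)
Definition merge_blocks (T : choiceType) (P : {fset {fset T}}) (v w : T) :
    {fset {fset T}} :=
  (fcover [fset A in P | (v \in A) || (w \in A)] |`
    [fset A in P | (v \notin A) && (w \notin A)])%fset.

Lemma is_diagram_merge k P v w : (0 < v.1 <= k)%N ->
  is_diagram (k, P) -> is_diagram (k, merge_blocks P v w).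
Proof.
move=> vk /is_diagramP[cP tP nP].
have mergeP A : reflect
    (A = fcover [fset A in P | (v \in A) || (w \in A)]%fset \/
     [/\ A \in P, v \notin A & w \notin A]) (A \in merge_blocks P v w).
  rewrite /merge_blocks; apply: (iffP (fset1UP _ _ _)) => -[->|]; [by left| |by left|].
    by rewrite !inE /= => /and3P[]; right.
  by case=> AP vA wA; right; rewrite !inE /= AP vA wA.
have coverE x : x \in fcover [fset A in P | (v \in A) || (w \in A)]%fset <->
    exists2 A, A \in P /\ x \in A & v \in A \/ w \in A.
  split=> [/fcoverP[A]|[A [AP xA] vw]].
    by rewrite !inE /= => /andP[AP /orP vw xA]; exists A.
  by apply/fcoverP; exists A => //; rewrite !inE /= AP; apply/orP.
apply/is_diagramP; split.
- move=> x; rewrite cP; split=> [[A AP xA]|[A /mergeP[->|[AP _ _]] xA]].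
  + have [vw|] := boolP ((v \in A) || (w \in A)).
      exists (fcover [fset A in P | (v \in A) || (w \in A)]%fset).
        by apply/mergeP; left.
      by apply/coverE; exists A => //; apply/orP.
    by rewrite negb_or => /andP[vA wA]; exists A => //; apply/mergeP; right.
  + by move: xA => /coverE[A' [A'P xA'] _]; exists A'.
  + by exists A.
- have aux A B x : A \in P -> v \notin A -> w \notin A -> x \in A ->
      x \in fcover [fset A in P | (v \in A) || (w \in A)]%fset -> A = B.
    move=> AP vA wA xA /coverE[A' [A'P xA'] vw].
    have AA' := tP A A' x AP A'P xA xA'; move: vA wA; rewrite AA'.
    by case: vw => ->.
  move=> A B x /mergeP[->|[AP vA wA]] /mergeP[->|[BP vB wB]] //.
  + by move=> xA xB; apply/esym/(aux _ _ x).
  + by move=> xA xB; apply/(aux _ _ x).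
  + exact: tP.
- move=> A /mergeP[->|[/nP]] //.
  have [B BP vB] := (cP v).1 vk.
  by exists v; apply/coverE; exists B => //; left.
Qed.

(* The labels k' and (k+1)' for k the order of p.                            *)
Definition bullet_blocks (p q : diagram) : {fset {fset nat * bool}} :=
  merge_blocks (otimes_blocks p q) (diag_order p, true) ((diag_order p).+1, true).

Definition bullet_val (p q : diagram) : nat * {fset {fset nat * bool}} :=
  if diag_order p == 0%N then val q else
  if diag_order q == 0%N then val p else
  ((diag_order p + diag_order q)%N, bullet_blocks p q).

Fact is_diagram_bullet p q : is_diagram (bullet_val p q).
Proof.
rewrite /bullet_val; case: eqP => [_|/eqP p0]; first exact: valP.
case: eqP => [_|_]; first exact: valP.
apply: is_diagram_merge; last exact: is_diagram_otimes.
by rewrite /= lt0n p0 leq_addr.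
Qed.

Definition bullet (p q : diagram) : diagram := Diagram (is_diagram_bullet p q).

Definition otimes_irreducible (p : diagram) : Prop :=
  forall q r, p = otimes q r -> q = diagram0 \/ r = diagram0.

Definition otimes_seq (s : seq diagram) : diagram := foldr otimes diagram0 s.

Definition is_factorization (p : diagram) (s : seq diagram) : Prop :=
  (forall q, q \in s -> q != diagram0 /\ otimes_irreducible q) /\ otimes_seq s = p.

(* The unique factorization of p.                                            *)
Definition factors (p : diagram) : seq diagram :=
  xget [::] [set s | is_factorization p s].

Lemma diag_order_gt0 p : p != diagram0 -> (0 < diag_order p)%N.
Proof.
move=> p0; rewrite lt0n; apply: contra p0 => /eqP kp; apply/eqP/val_inj.
have /is_diagramP[cp _ np] := diagram_axioms p.
rewrite [val p]surjective_pairing -/(diag_order p) -/(blocks p) kp /=.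
congr pair; apply/fsetP => A; rewrite inE; apply/negP => Ap.
have [v vA] := np A Ap; have /(cp v) : exists2 A, A \in blocks p & v \in A.
  by exists A.
by rewrite kp; case: v.1.
Qed.

Lemma diag_order_otimes p q : diag_order (otimes p q) = (diag_order p + diag_order q)%N.
Proof. by []. Qed.

Lemma otimes0p : left_id diagram0 otimes.
Proof.
move=> p; apply: val_inj; rewrite [RHS]surjective_pairing; congr pair.
apply/fsetP => A; rewrite /= /otimes_blocks !inE /=.
have sh0 B : shift_block 0 B = B.
  by apply/fsetP => v; apply/imfsetP/idP => [[w /= + ->]|vB];
    [|exists v => //]; rewrite /shift_label addn0 -surjective_pairing.
apply/imfsetP/idP => [[B /= Bp ->]|Ap]; first by rewrite sh0.
by exists A; rewrite //= sh0.
Qed.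

Lemma otimesp0 : right_id diagram0 otimes.
Proof.
move=> p; apply: val_inj; rewrite [RHS]surjective_pairing; congr pair.
  by rewrite /= addn0.
apply/fsetP => A; rewrite /= /otimes_blocks in_fsetU.
by apply/orP/idP => [[//|/imfsetP[B]]|]; [rewrite inE|left].
Qed.

Lemma otimesA : associative otimes.
Proof.
move=> p q r; apply: val_inj; congr pair; first by rewrite /= addnA.
have shD B : shift_block (diag_order p) (shift_block (diag_order q) B) =
    shift_block (diag_order (otimes p q)) B.
  rewrite /shift_block -imfset_comp /=; apply: eq_imfset => // v.
  by rewrite /shift_label /= -addnA [(diag_order q + _)%N]addnC.
apply/fsetP => A; rewrite /= /otimes_blocks /= /otimes_blocks !in_fsetU.
apply/idP/idP => [/orP[->//|/imfsetP[B /= + ->]]|].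
  rewrite in_fsetU => /orP[Bq|/imfsetP[C /= Cr ->]]; apply/orP.
    by left; apply/orP; right; apply/imfsetP; exists B.
  by right; rewrite shD; apply/imfsetP; exists C.
move=> /orP[/orP[->//|/imfsetP[B /= Bq ->]]|/imfsetP[B /= Br ->]]; apply/orP; right.
  by apply/imfsetP; exists B => //=; rewrite in_fsetU Bq.
rewrite -shD; apply/imfsetP; exists (shift_block (diag_order q) B) => //=.
by rewrite in_fsetU; apply/orP; right; apply/imfsetP; exists B.
Qed.

Lemma otimes_seq_cat s t :
  otimes_seq (s ++ t) = otimes (otimes_seq s) (otimes_seq t).
Proof.
by elim: s => [|p s IH] /=; rewrite ?otimes0p // IH otimesA.
Qed.

Lemma factorization_exists p : exists s, is_factorization p s.
Proof.
have [n] := ubnP (diag_order p); elim: n p => // n IH p pn.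
have [->|p0] := eqVneq p diagram0; first by exists [::]; split.
have [pI|] := pselect (otimes_irreducible p).
  exists [:: p]; split=> [q|]; last exact: otimesp0.
  by rewrite inE => /eqP ->.
move=> /existsNP[q /existsNP[r /not_implyP[pE /not_orP[/eqP q0 /eqP r0]]]].
have pqr : diag_order p = (diag_order q + diag_order r)%N by rewrite pE.
have [q1 r1] := (diag_order_gt0 q0, diag_order_gt0 r0).
have [|s [hs sE]] := IH q.
  by rewrite (leq_trans _ (ltnSE pn)) // pqr -addn1 leq_add2l.
have [|t [ht tE]] := IH r.
  by rewrite (leq_trans _ (ltnSE pn)) // pqr -add1n leq_add2r.
exists (s ++ t); split; last by rewrite otimes_seq_cat sE tE.
by move=> u; rewrite mem_cat => /orP[/hs|/ht].
Qed.

Lemma factorsK p : otimes_seq (factors p) = p.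
Proof.
rewrite /factors; case: xgetP => [s _ [_ ->] //|h].
by have [s /h] := factorization_exists p.
Qed.

Lemma factorsP p q : q \in factors p -> q != diagram0 /\ otimes_irreducible q.
Proof.
by rewrite /factors; case: xgetP => [s _ [h _] /h|].
Qed.

Lemma factors0 : factors diagram0 = [::].
Proof.
rewrite /factors; case: xgetP => // -[|q s] _ [h e] //.
have [/diag_order_gt0 q0 _] := h q (mem_head _ _).
by have := congr1 diag_order e; rewrite /= diag_order_otimes; case: (diag_order q) q0.
Qed.

Definition composition := {a : seq nat | 0%N \notin a}.

Fact factors_composition p : 0%N \notin [seq diag_order q | q <- factors p].
Proof. by apply/mapP => -[q /factorsP[/diag_order_gt0]] + _ q0; rewrite -q0. Qed.

Definition factor_orders (p : diagram) : composition :=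
  exist (fun a : seq nat => 0%N \notin a) _ (factors_composition p).

Lemma finite_coproduct_index r :
  finite_set [set pq : diagram * diagram | otimes pq.1 pq.2 = r].
Proof.
pose f (pq : diagram * diagram) :=
  ((diag_order pq.1, diag_order pq.2), (blocks pq.1,
    [fset shift_block (diag_order pq.1) A | A in blocks pq.2]%fset)).
pose I := `I_(diag_order r).+1; pose P := [set` fpowerset (blocks r)].
pose B := (I `*` I) `*` (P `*` P).
have Bfin : finite_set B.
  by do !apply: finite_setX; do ?[exact: finite_II|exact: finite_fset].
have shI k : injective (shift_block k).
  have shI1 : injective (shift_label k) by move=> [i b] [j c] [/addIn -> ->].
  move=> A A' AA'; apply/fsetP => v; have/fsetP/(_ (shift_label k v)) := AA'.
  by rewrite !(mem_imfset _ _ shI1).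
have fI : {in f @^-1` B &, injective f}.
  move=> [p q] [p' q'] _ _ [kp kq bp bq].
  congr pair; apply: val_inj; rewrite [LHS]surjective_pairing [RHS]surjective_pairing.
    by congr pair.
  congr pair => //; apply/fsetP => A.
  have/fsetP/(_ (shift_block (diag_order p) A)) := bq.
  by rewrite -kp !(mem_imfset _ _ (shI _)).
apply: (sub_finite_set _ (finite_preimage fI Bfin)) => -[p q] /= pqr.
rewrite /B /I /P /f -{}pqr; split; split; rewrite /= ?fpowersetE ?ltnS.
- exact: leq_addr.
- exact: leq_addl.
- exact: fsubsetUl.
- exact: fsubsetUr.
Qed.

Definition nonempty (s : seq diagram) : seq diagram :=
  [seq p <- s | p != diagram0].

(* A pair of sequences of the same length k is encoded as a sequence of k    *)
(* pairs.                                                                    *)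
Definition product_index (p q : diagram) : set (seq (diagram * diagram)) :=
  [set s | [/\ nonempty (unzip1 s) = factors p, nonempty (unzip2 s) = factors q
             & all (fun rt => bullet rt.1 rt.2 != diagram0) s]].

Lemma bullet0p q : bullet diagram0 q = q.
Proof. exact: val_inj. Qed.

Lemma finite_product_index p q : finite_set (product_index p q).
Proof.
pose B (p : diagram) := [set x | x \in diagram0 :: factors p].
have Bfin : finite_set (B p `*` B q).
  by apply: finite_setX; exact: (finite_seq (diagram0 :: _)).
pose S n := [set s : seq (diagram * diagram) |
  (size s <= n)%N /\ {in s, forall rt, (B p `*` B q) rt}].
have Sfin n : finite_set (S n).
  elim: n => [|n IH].
    by apply: (sub_finite_set _ (finite_set1 [::])) => -[|rt s] [].
  have hfin : finite_set ([set [::]] `|`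
      (fun x => x.1 :: x.2) @` ((B p `*` B q) `*` S n)).
    rewrite finite_setU; split; first exact: finite_set1.
    exact/finite_image/finite_setX.
  apply: sub_finite_set hfin => -[|rt s] [/= sn sB]; first by left.
  right; exists (rt, s) => //; split; first exact/sB/mem_head.
  by split=> // x xs; apply: sB; rewrite in_cons xs orbT.
apply: (sub_finite_set _ (Sfin (size (factors p) + size (factors q))%N)).
move=> s [sp sq sne]; split.
  rewrite -sp -sq; elim: s sne {sp sq} => //= -[r t] s IH /= /andP[rt /IH].
  rewrite /nonempty /= => h; have [r0|r0] /= := eqVneq r diagram0.
    by move: rt; rewrite r0 bullet0p => ->; rewrite /= addnS ltnS.
  by rewrite addSn ltnS (leq_trans h) // leq_add2l; case: ifP => //= _.
move=> [r t] rts; split; rewrite /B /= in_cons.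
  by rewrite -sp mem_filter (map_f fst rts); case: eqP.
by rewrite -sq mem_filter (map_f snd rts); case: eqP.
Qed.

Section ParQSym.
Variable K : fieldType.

Definition parqsym := {malg K[diagram]}.
HB.instance Definition _ := GRing.Lmodule.on parqsym.

Definition Mpar (p : diagram) : parqsym := << p >>.

Definition Mpar_mul (p q : diagram) : parqsym :=
  if p == diagram0 then Mpar q else
  if q == diagram0 then Mpar p else
  \sum_(s \in product_index p q)
    Mpar (otimes_seq [seq bullet rt.1 rt.2 | rt <- s]).

Definition parqsym_mul (x y : parqsym) : parqsym :=
  lin_ext (fun p => lin_ext (fun q => Mpar_mul p q) y) x.

Definition parqsym_comul : parqsym -> tensor parqsym parqsym :=
  lin_ext (fun r => \sum_(pq \in [set pq | otimes pq.1 pq.2 = r])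
                      Mpar pq.1 \ox Mpar pq.2).

Definition parqsym_counit : parqsym -> K :=
  lin_ext (fun p => (p == diagram0)%:R : K^o).

Definition parqsym_deg (n : nat) : set parqsym :=
  lspan [set x | exists2 p, diag_order p = n & x = Mpar p].

Definition ParQSym : graded_bialgebra_data parqsym :=
  GradedBialgebraData parqsym_mul (Mpar diagram0) parqsym_comul
    parqsym_counit parqsym_deg.

End ParQSym.

(* The nonzero exponents of a monomial in the variables x_0, x_1, ..., in    *)
(* the order of the variables.                                               *)
Definition exponents (m : {cmonom nat}) : seq nat :=
  [seq m i | i <- sort leq (finsupp m)].

Lemma mdeg_exponents m : mdeg m = sumn (exponents m).
Proof.
rewrite mdegE sumnE big_map; apply/esym/perm_big; exact: permEl (perm_sort _ _).
Qed.

Section QSym.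
Variable K : fieldType.

(* A formal power series is given by its coefficients.                       *)
Definition quasisymmetric (f : {cmonom nat} -> K^o) : Prop :=
  (exists d, forall m, f m != 0 -> (mdeg m <= d)%N) /\
  (forall m m', exponents m = exponents m' -> f m = f m').

Definition qsym_pred : {pred {cmonom nat} -> K^o} :=
  fun f => `[< quasisymmetric f >].

Fact qsym_submod : submod_closed qsym_pred.
Proof.
split; first by apply/asboolP; split=> //; exists 0%N => m; rewrite eqxx.
move=> a f g /asboolP[[d fd] fq] /asboolP[[e ge] gq]; apply/asboolP; split.
  exists (maxn d e) => m; rewrite leq_max => h.
  have [fm0|/fd ->//] := eqVneq (f m) 0.
  rewrite (ge m) ?orbT //; apply: contra h => /eqP gm0; apply/eqP.
  by rewrite -[LHS]/(a *: f m + g m) fm0 gm0 scaler0 addr0.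
by move=> m m' mm'; congr (a *: _ + _); [exact: fq|exact: gq].
Qed.

HB.instance Definition _ :=
  GRing.isSubmodClosed.Build K ({cmonom nat} -> K^o) qsym_pred qsym_submod.

Record qsym := QSymSeries {
  qsym_val :> {cmonom nat} -> K^o;
  _ : qsym_val \in qsym_pred
}.

HB.instance Definition _ := [isSub for qsym_val].
HB.instance Definition _ := [Choice of qsym by <:].
HB.instance Definition _ := [SubChoice_isSubLmodule of qsym by <:].

(* M_a : every monomial x_(i_1)^(a_1) ... x_(i_p)^(a_p) with                 *)
(* i_1 < ... < i_p has coefficient 1.                                        *)
Fact Mqsym_subproof (a : composition) :
  (fun m => (exponents m == val a)%:R : K^o) \in qsym_pred.
Proof.
apply/asboolP; split=> [|m m' -> //]; exists (sumn (val a)) => m.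
have [<- _|_] := eqVneq (exponents m) (val a); last by rewrite eqxx.
by rewrite mdeg_exponents.
Qed.

Definition Mqsym (a : composition) : qsym := QSymSeries (Mqsym_subproof a).

(* The monomial x_0^(a_1) ... x_(p-1)^(a_p): its coefficient in a            *)
(* quasisymmetric function f is the coordinate of f on M_a.                  *)
Definition leading_monomial (a : composition) : {cmonom nat} :=
  [cmonom nth 0%N (val a) i | i in [fset j in iota 0 (size (val a))]]%M.

Lemma finsupp_leading_monomial a :
  finsupp (leading_monomial a) = [fset j in iota 0 (size (val a))]%fset.
Proof.
apply/fsetP => i; rewrite -cmE_neq0 /leading_monomial cmE /= fsfunE !inE.
case: ifP => // /[!mem_iota] /andP[_ /= ia]; apply/eqP => a0.
by have := valP a; rewrite -[X in X \notin _]a0 mem_nth.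
Qed.

Lemma exponents_leading_monomial a : exponents (leading_monomial a) = val a.
Proof.
have sE : sort leq (finsupp (leading_monomial a)) = iota 0 (size (val a)).
  apply: (sorted_eq leq_trans anti_leq); first exact: (sort_sorted leq_total).
    exact: iota_sorted.
  rewrite perm_sort finsupp_leading_monomial; apply: uniq_perm.
  - exact: fset_uniq.
  - exact: iota_uniq.
  by move=> i; rewrite !inE.
rewrite /exponents sE; apply: (@eq_from_nth _ 0%N); rewrite size_map size_iota //.
move=> i ia; rewrite (nth_map 0%N) ?size_iota // nth_iota // add0n.
by rewrite /leading_monomial cmE /= fsfunE !inE mem_iota /= add0n ia.
Qed.

Lemma Mqsym_leading_monomial a b :
  Mqsym a (leading_monomial b) = (a == b)%:R.
Proof. by rewrite /= exponents_leading_monomial (inj_eq val_inj) eq_sym. Qed.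

(* The value on the empty composition is 0 since last 0 [::] = 0.            *)
Definition eta_weight (a : composition) : K :=
  (-1) ^+ (size (val a)).-1 * (last 0%N (val a))%:R.

Definition eta_qsym (f : qsym) : K :=
  \sum_(a \in [set: composition]) f (leading_monomial a) * eta_weight a.

Lemma finite_compositions d :
  finite_set [set a : composition | (sumn (val a) <= d)%N].
Proof.
pose S := [set s : seq nat | (0%N \notin s) && (sumn s <= d)%N].
have Sfin : finite_set S.
  rewrite /S; elim: {S} d => [|d IH].
    apply: (sub_finite_set _ (finite_set1 [::])) => -[|n s] //= /andP[].
    by rewrite in_cons leqn0 addn_eq0; case: n.
  have hfin : finite_set ([set [::]] `|`
      (fun p => p.1 :: p.2) @` (`I_d.+2 `*`
        [set s : seq nat | (0%N \notin s) && (sumn s <= d)%N])).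
    rewrite finite_setU; split; first exact: finite_set1.
    exact/finite_image/finite_setX.
  apply: sub_finite_set hfin.
  move=> [|n s] /=; first by left.
  rewrite in_cons negb_or => /andP[/andP[n0 s0] nsd]; right.
  exists (n, s) => //; split=> /=.
    by rewrite /= ltnS; apply: leq_trans nsd; exact: leq_addr.
  rewrite s0 /= -ltnS (leq_trans _ nsd) // -[X in (X < _)%N]add0n ltn_add2r.
  by rewrite lt0n eq_sym.
have -> : [set a : composition | (sumn (val a) <= d)%N] = val @^-1` S.
  by apply/seteqP; split=> a /=; rewrite /S /= (valP a).
by apply: finite_preimage => // a b _ _; exact: val_inj.
Qed.

Lemma etaEw (f : qsym) d : (forall m, f m != 0 -> (mdeg m <= d)%N) ->
  eta_qsym f = \sum_(a \in [set a : composition | (sumn (val a) <= d)%N])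
            f (leading_monomial a) * eta_weight a.
Proof.
move=> fd; apply/esym/fsbig_widen => // a [_ /= /negP]; rewrite -ltnNge => ad.
have [->|/fd] := eqVneq (f (leading_monomial a)) 0; first by rewrite mul0r.
by rewrite mdeg_exponents exponents_leading_monomial leqNgt ad.
Qed.

Fact eta_scalar : scalar eta_qsym.
Proof.
move=> c f g.
have /asboolP[[d fd] _] := valP f; have /asboolP[[e ge] _] := valP g.
have le_m h n : (forall m, (h : qsym) m != 0 -> (mdeg m <= n)%N) ->
    (n <= maxn d e)%N -> forall m, h m != 0 -> (mdeg m <= maxn d e)%N.
  by move=> hn nde m /hn /leq_trans; apply.
have {}fd := le_m f d fd (leq_maxl _ _).
have {}ge := le_m g e ge (leq_maxr _ _).
have hfg : forall m, (c *: f + g) m != 0 -> (mdeg m <= maxn d e)%N.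
  move=> m; have [fm0|/fd ->//] := eqVneq (f m) 0.
  have [gm0|/ge ->//] := eqVneq (g m) 0.
  by rewrite -[X in X != 0]/(c *: f m + g m) fm0 gm0 scaler0 addr0 eqxx.
rewrite (etaEw fd) (etaEw ge) (etaEw hfg) mulr_fsumr.
rewrite -fsbig_split; last exact: finite_compositions.
apply: eq_fsbigr => a _.
transitivity ((c * f (leading_monomial a) + g (leading_monomial a)) *
  eta_weight a) => //.
by rewrite mulrDl -mulrA.
Qed.

Lemma eta_Mqsym a : eta_qsym (Mqsym a) = eta_weight a.
Proof.
rewrite /eta_qsym -(fsbig_widen [set a]) // => [|b [_ /= /eqP]].
  by rewrite fsbig_set1 Mqsym_leading_monomial eqxx mul1r.
move=> ba; rewrite exponents_leading_monomial.
by rewrite (inj_eq val_inj) (negPf ba) mul0r.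
Qed.

End QSym.

Section Maps.
Variable K : fieldType.

Definition PsiPQ : parqsym K -> qsym K := lin_ext (fun p => Mqsym K (factor_orders p)).

Definition eta_parqsym : parqsym K -> K := @eta_qsym K \o PsiPQ.

End Maps.

(* Main.v *)
Require Import Defs.
From mathcomp Require Import all_boot all_order all_algebra.
From mathcomp Require Import finmap all_classical.
From mathcomp Require Import multinomials.monalg.

(* Diagrams under otimes form a free monoid on the letters, i.e. the non-empty
   irreducible diagrams, and bullet is an associative operation on letters.
   Hence ParQSym is the quasi-shuffle algebra on words of letters, with
   deconcatenation as coproduct. All Hopf algebra axioms are identities between
   sums over quasi-shuffles and splittings of words, which follow by induction
   from
     (a u) * (b v) = a (u * b v) + b (a u * v) + (a bullet b) (u * v).
   On words eta satisfies eta (a w) = - eta w for w non-empty and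
   eta a = order of a; so eta (u * v) = 0 for non-empty u and v follows from the
   same recursion, because the order is additive under bullet.                *)

(** Freeness of the monoid is the laborious part: diagrams are finite sets of blocks, awkward to
    compare after shifts and merges. They are compared instead through the predicates constant on
    every block. For these predicates [otimes] is a conjunction of conditions, and [bullet] of
    non-empty diagrams adds one equivalence. A diagram factors exactly at the levels that no block
    crosses. This yields Levi's lemma, hence unique factorization. It also shows that letters are
    closed under [bullet]: the only level not already excluded by the two factors is the seam, and
    the merged block crosses it. A word may occur several times among the quasi-shuffles of two
    words, so these are kept as lists. The product of ParQSym sums over a set of padded pairs of
    sequences; a duplicate-free enumeration of that set connects the two. The antipode is built by
    recursion as a right convolution inverse; that it is also a left inverse follows from
    associativity of convolution. *)

Set Implicit Arguments.
Unset Strict Implicit.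
Unset Printing Implicit Defensive.

Import GRing.Theory.

Local Open Scope ring_scope.

(** * Quasi-shuffles and splittings of words *)

Section QuasiShuffle.
Variables (L : Type) (op : L -> L -> L).

(** The nested [fix] lets a recursive call shorten either argument alone. *)
Fixpoint qshuffle (u : seq L) : seq L -> seq (seq L) :=
  fix qshuffle_u v :=
    match u, v with
    | [::], _ => [:: v]
    | _, [::] => [:: u]
    | a :: u', b :: v' =>
      [seq a :: w | w <- qshuffle u' v] ++ [seq b :: w | w <- qshuffle_u v'] ++
      [seq op a b :: w | w <- qshuffle u' v']
    end.

Fixpoint splits (w : seq L) : seq (seq L * seq L) :=
  ([::], w) ::
  if w is a :: w' then [seq (a :: xy.1, xy.2) | xy <- splits w'] else [::].

#[global] Arguments qshuffle : simpl never.
#[global] Arguments splits : simpl never.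

Lemma splits_cons a w :
  splits (a :: w) = ([::], a :: w) :: [seq (a :: xy.1, xy.2) | xy <- splits w].
Proof. by []. Qed.

Lemma qshuffle0s v : qshuffle [::] v = [:: v]. Proof. by case: v. Qed.

Lemma qshuffles0 u : qshuffle u [::] = [:: u]. Proof. by case: u. Qed.

Lemma qshuffle_cons a u b v :
  qshuffle (a :: u) (b :: v) =
  [seq a :: w | w <- qshuffle u (b :: v)] ++
  [seq b :: w | w <- qshuffle (a :: u) v] ++
  [seq op a b :: w | w <- qshuffle u v].
Proof. by []. Qed.

Variable V : nmodType.
Implicit Types (F : seq L -> V).

Lemma big_qshuffle0s v F : \sum_(w <- qshuffle [::] v) F w = F v.
Proof. by rewrite qshuffle0s big_seq1. Qed.

Lemma big_qshuffles0 u F : \sum_(w <- qshuffle u [::]) F w = F u.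
Proof. by rewrite qshuffles0 big_seq1. Qed.

Lemma big_qshuffle_cons a u b v F :
  \sum_(w <- qshuffle (a :: u) (b :: v)) F w =
  \sum_(w <- qshuffle u (b :: v)) F (a :: w) +
  \sum_(w <- qshuffle (a :: u) v) F (b :: w) +
  \sum_(w <- qshuffle u v) F (op a b :: w).
Proof. by rewrite qshuffle_cons !big_cat !big_map /= addrA. Qed.

Lemma qshuffle_nonnil a u v : all (fun w => 0 < size w)%N (qshuffle (a :: u) v).
Proof.
case: v => [|b v] //; rewrite qshuffle_cons !all_cat !all_map /=.
by apply/and3P; split; exact: all_predT.
Qed.

Lemma big_splits_nil (F : seq L * seq L -> V) :
  \sum_(xy <- splits [::]) F xy = F ([::], [::]).
Proof. by rewrite big_seq1. Qed.

Lemma big_splits_cons a w (F : seq L * seq L -> V) :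
  \sum_(xy <- splits (a :: w)) F xy =
  F ([::], a :: w) + \sum_(xy <- splits w) F (a :: xy.1, xy.2).
Proof. by rewrite splits_cons big_cons big_map. Qed.

(** Coassociativity of deconcatenation: both sides run over the cuts of [w] into three consecutive
    pieces. In the induction the first letter is absorbed into the first argument of [F]. *)
Lemma splitsA w (F : seq L -> seq L -> seq L -> V) :
  \sum_(xy <- splits w) \sum_(zt <- splits xy.1) F zt.1 zt.2 xy.2 =
  \sum_(xy <- splits w) \sum_(zt <- splits xy.2) F xy.1 zt.1 zt.2.
Proof.
elim: w F => [|a w IH] F; first by rewrite !big_splits_nil.
rewrite big_splits_cons /= big_splits_nil.
under eq_bigr do rewrite big_splits_cons.
by rewrite [RHS]big_splits_cons big_splits_cons big_split (IH (F \o cons a)) addrA.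
Qed.

(** The combinatorial core of multiplicativity of the coproduct. Both sides are sorted by whether
    the left piece is empty and, if not, by its first letter [a], [b] or [op a b]; removing that
    letter leaves a shorter instance. *)
Lemma splits_qshuffle u v (F : seq L -> seq L -> V) :
  \sum_(w <- qshuffle u v) \sum_(xy <- splits w) F xy.1 xy.2 =
  \sum_(p <- splits u) \sum_(q <- splits v)
    \sum_(x <- qshuffle p.1 q.1) \sum_(y <- qshuffle p.2 q.2) F x y.
Proof.
have [n] := ubnP (size u + size v)%N.
elim: n u v F => // n IH [|a u] v F szn.
  rewrite big_qshuffle0s big_splits_nil; apply: eq_bigr => xy _.
  by rewrite !big_qshuffle0s.
case: v szn => [|b v] szn.
  rewrite big_qshuffles0; apply: eq_bigr => xy _.
  by rewrite big_splits_nil !big_qshuffles0.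
rewrite big_qshuffle_cons.
under eq_bigr do rewrite big_splits_cons.
under [X in _ + X + _ = _]eq_bigr do rewrite big_splits_cons.
under [X in _ + X = _]eq_bigr do rewrite big_splits_cons.
rewrite !big_split /=.
rewrite !(IH _ _ (fun x y => F (_ :: x) y)) ?(IH u (b :: v)) ?(IH (a :: u) v) ?(IH u v);
    do ?by move: szn; rewrite /= ?addSn ?addnS !ltnS //; apply: leq_trans;
    rewrite ?addSn ?addnS ?leqnSn.
rewrite [RHS]big_splits_cons [X in _ = X + _]big_splits_cons /=.
rewrite [X in _ = X + _ + _]big_qshuffle0s [X in _ = X + _ + _]big_qshuffle_cons.
under [X in _ = _ + X]eq_bigr do rewrite big_splits_cons /= big_qshuffles0.
under [X in _ = _ + X]eq_bigr do
  under [X in _ + X]eq_bigr do rewrite big_qshuffle_cons.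
under [X in _ + X + _ + _ = _]eq_bigr do rewrite big_splits_cons /= big_qshuffles0.
rewrite [X in _ + (_ + X) + _ = _]big_splits_cons /=.
under [X in _ + (_ + (X + _)) + _ = _]eq_bigr do rewrite big_qshuffle0s.
under [X in _ = _ + X + _]eq_bigr do rewrite big_qshuffle0s.
under [X in _ = _ + X]eq_bigr do rewrite !big_split.
rewrite !big_split !addrA.
(* In the order of the right-hand side: 1, 4, 7 have an empty left piece; in 5 and 2 only one of the
   two words contributes to it; in 3, 6, 8 both do. *)
by rewrite [LHS](ACl (1*4*7*5*2*3*6*8)).
Qed.

Hypothesis opA : associative op.

(** The first letter of a triple quasi-shuffle comes from one of the seven non-empty subsets of [a],
    [b], [c]. Each subset gives a shorter instance, and associativity of [op] is used when all three
    letters merge. *)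
Lemma qshuffleA u v t F :
  \sum_(w <- qshuffle u v) \sum_(x <- qshuffle w t) F x =
  \sum_(w <- qshuffle v t) \sum_(x <- qshuffle u w) F x.
Proof.
have [n] := ubnP (size u + size v + size t)%N.
elim: n u v t F => // n IH [|a u] v t F szn.
  by rewrite big_qshuffle0s; under [RHS]eq_bigr do rewrite big_qshuffle0s.
case: v szn => [|b v] szn; first by rewrite big_qshuffles0 big_qshuffle0s.
case: t szn => [|c t] /= szn.
  by under eq_bigr do rewrite big_qshuffles0; rewrite big_qshuffles0.
rewrite !big_qshuffle_cons.
under eq_bigr do rewrite big_qshuffle_cons.
under [X in _ + X + _ = _]eq_bigr do rewrite big_qshuffle_cons.
under [X in _ + X = _]eq_bigr do rewrite big_qshuffle_cons.
under [X in _ = X + _ + _]eq_bigr do rewrite big_qshuffle_cons.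
under [X in _ = _ + X + _]eq_bigr do rewrite big_qshuffle_cons.
under [X in _ = _ + X]eq_bigr do rewrite big_qshuffle_cons.
rewrite !big_split /=.
have lt k : (k < (size u).+1 + (size v).+1 + (size t).+1)%N -> (k < n)%N.
  by move=> /leq_trans; apply.
(* The words led by [c] alone are scattered over three sums on the left, and those led by [a] alone
   over three sums on the right. They have to be reassembled into a full quasi-shuffle before the
   induction hypothesis applies. *)
have c_part :
    \sum_(w <- qshuffle u (b :: v)) \sum_(x <- qshuffle (a :: w) t) F (c :: x) +
    \sum_(w <- qshuffle (a :: u) v) \sum_(x <- qshuffle (b :: w) t) F (c :: x) +
    \sum_(w <- qshuffle u v) \sum_(x <- qshuffle (op a b :: w) t) F (c :: x) =
    \sum_(w <- qshuffle (b :: v) t) \sum_(x <- qshuffle (a :: u) w) F (c :: x).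
  rewrite -(big_qshuffle_cons a u b v (fun w => \sum_(x <- qshuffle w t) F (c :: x))).
  by apply: IH; apply: lt; rewrite /= !addnS.
have a_part :
    \sum_(w <- qshuffle u (b :: v)) \sum_(x <- qshuffle w (c :: t)) F (a :: x) =
    \sum_(w <- qshuffle v (c :: t)) \sum_(x <- qshuffle u (b :: w)) F (a :: x) +
    \sum_(w <- qshuffle (b :: v) t) \sum_(x <- qshuffle u (c :: w)) F (a :: x) +
    \sum_(w <- qshuffle v t) \sum_(x <- qshuffle u (op b c :: w)) F (a :: x).
  rewrite -(big_qshuffle_cons b v c t (fun w => \sum_(x <- qshuffle u w) F (a :: x))).
  by apply: IH; apply: lt; rewrite /= !addSn.
(* The other five leading letters need no reassembly. *)
have H u' v' t' f : (size u' + size v' + size t' <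
    (size u).+1 + (size v).+1 + (size t).+1)%N ->
    \sum_(w <- qshuffle u' v') \sum_(x <- qshuffle w t') F (f :: x) =
    \sum_(w <- qshuffle v' t') \sum_(x <- qshuffle u' w) F (f :: x).
  by move=> /lt h; apply: IH.
rewrite a_part.
rewrite (H (a :: u) v (c :: t) b) /=; last by rewrite !addSn !addnS ltnS.
rewrite (H u v (c :: t) (op a b)) /=; last by rewrite !addSn !addnS !ltnS leqnSn.
rewrite (H (a :: u) v t (op b c)) /=; last by rewrite !addSn !addnS !ltnS leqnSn.
rewrite (H u v t (op (op a b) c)) /=; last first.
  by rewrite !addSn !addnS !ltnS (leq_trans (leqnSn _)).
rewrite (H u (b :: v) t (op a c)) /=; last by rewrite !addSn !addnS !ltnS leqnSn.
rewrite -c_part opA !addrA.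
by rewrite [LHS](ACl (1*6*9*2*4*7*10*5*3*8*11)).
Qed.

End QuasiShuffle.

(** * The free monoid of diagrams *)

Section Diagrams.
Implicit Types (p q r : diagram) (S : nat * bool -> Prop).

(** On the labels covered by [P], such an [S] is a union of blocks. *)
Definition saturated (P : {fset {fset nat * bool}}) S : Prop :=
  forall A v w, A \in P -> v \in A -> w \in A -> S v -> S w.

Lemma block_label p A v :
  A \in blocks p -> v \in A -> (0 < v.1 <= diag_order p)%N.
Proof.
by have /is_diagramP[cp _ _] := diagram_axioms p; move=> Ap vA; apply/cp; exists A.
Qed.

(** Each block is itself a saturated predicate, so a block of [p] and a block of [q] that share a
    label contain each other. *)
Lemma diagram_ext p q : diag_order p = diag_order q ->
  (forall S, saturated (blocks p) S <-> saturated (blocks q) S) -> p = q.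
Proof.
move=> pq_ord pqS; apply: val_inj; rewrite [LHS]surjective_pairing.
rewrite [RHS]surjective_pairing; congr pair => //.
have sub r s : diag_order r = diag_order s ->
    (forall S, saturated (blocks r) S <-> saturated (blocks s) S) ->
    {subset blocks r <= blocks s}.
  move=> rs_ord rsS A Ar.
  have /is_diagramP[cr tr nr] := diagram_axioms r.
  have /is_diagramP[cs ts ns] := diagram_axioms s.
  have [v vA] := nr A Ar.
  have [|B Bs vB] := (cs v).1; first by rewrite -rs_ord (block_label Ar).
  suff -> : A = B by [].
  have satA : saturated (blocks s) (fun w => w \in A).
    by apply/rsS => C x y Cr xC yC xA; rewrite (tr A C x).
  have satB : saturated (blocks r) (fun w => w \in B).
    by apply/rsS => C x y Cs xC yC xB; rewrite (ts B C x).
  apply/fsetP => w; apply/idP/idP => wAB; first exact: (satB A v).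
  exact: (satA B v).
apply/fsetP => A; apply/idP/idP; apply: sub => // S.
by split=> /pqS.
Qed.

Lemma saturated_otimes p q S :
  saturated (blocks (otimes p q)) S <->
  saturated (blocks p) S /\
  saturated (blocks q) (fun v => S (shift_label (diag_order p) v)).
Proof.
split=> [h|[hp hq] A v w]; first split=> [A v w Ap|A v w Aq vA wA].
- by apply: h; apply/fsetUP; left.
- apply: (h (shift_block (diag_order p) A)); last 2 first.
  + exact: in_imfset.
  + exact: in_imfset.
  by apply/fsetUP; right; apply/imfsetP; exists A.
- move=> /fsetUP[Ap|/imfsetP[B /= Bq ->]]; first exact: hp.
  by move=> /imfsetP[x /= xB ->] /imfsetP[y /= yB ->]; exact: (hq B).
Qed.

Lemma saturated_merge (P : {fset {fset nat * bool}}) x y S :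
  (exists2 A, A \in P & x \in A) -> (exists2 A, A \in P & y \in A) ->
  saturated (merge_blocks P x y) S <-> saturated P S /\ (S x <-> S y).
Proof.
move=> [X XP xX] [Y YP yY]; set P' := [fset A in P | (x \in A) || (y \in A)]%fset.
have inP' A z : A \in P -> (x \in A) || (y \in A) -> z \in A -> z \in fcover P'.
  by move=> AP Axy zA; apply/fcoverP; exists A => //; rewrite !inE /= AP.
have mP' : fcover P' \in merge_blocks P x y by exact: fset1U1.
have xP' : x \in fcover P' by apply: (inP' X); rewrite ?xX.
have yP' : y \in fcover P' by apply: (inP' Y); rewrite ?yY ?orbT.
split=> [h|[h xy] B v w].
  split; last by split; apply: (h _ _ _ mP').
  move=> A v w AP vA wA; have [Axy|Axy] := boolP ((x \in A) || (y \in A)).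
    by apply: (h _ _ _ mP'); exact: (inP' A).
  apply: (h A) => //; apply/fset1UP; right.
  by rewrite !inE /= AP -negb_or.
move=> /fset1UP[->|]; last by rewrite !inE /= => /andP[BP _]; exact: h.
have toxy z : z \in fcover P' -> S z <-> S x.
  move=> /fcoverP[A]; rewrite !inE /= => /andP[AP /orP[xA|yA]] zA.
    by split; apply: (h A).
  by rewrite xy; split; apply: (h A).
by move=> /toxy vx /toxy wx /vx /wx.
Qed.

Lemma diag_order_bullet p q :
  diag_order (bullet p q) = (diag_order p + diag_order q)%N.
Proof.
rewrite /diag_order /= /bullet_val; case: eqP => [p0|_].
  by rewrite /diag_order in p0; rewrite p0.
by case: eqP => // q0; rewrite /diag_order in q0; rewrite q0 addn0.
Qed.

Lemma bulletp0 p : bullet p diagram0 = p.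
Proof.
apply: val_inj; rewrite /= /bullet_val; case: eqP => // p0.
by have [->//|/diag_order_gt0] := eqVneq p diagram0; rewrite p0.
Qed.

Lemma saturated_bullet p q S : p != diagram0 -> q != diagram0 ->
  saturated (blocks (bullet p q)) S <->
  [/\ saturated (blocks p) S,
      saturated (blocks q) (fun v => S (shift_label (diag_order p) v)) &
      S (diag_order p, true) <-> S ((diag_order p).+1, true)].
Proof.
move=> /diag_order_gt0 p0 /diag_order_gt0 q0.
have -> : blocks (bullet p q) = bullet_blocks p q.
  by rewrite /blocks /= /bullet_val !gtn_eqF.
have /is_diagramP[cov _ _] := is_diagram_otimes p q.
rewrite saturated_merge -?saturated_otimes.
- rewrite -[otimes_blocks p q]/(blocks (otimes p q)) saturated_otimes.
  by split=> [[[]]|[]].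
- by apply/cov; rewrite /= p0 leq_addr.
- by apply/cov; rewrite /= -addn1 leq_add2l.
Qed.

Lemma diag_order_eq0 p : (diag_order p == 0%N) = (p == diagram0).
Proof.
have [->|/diag_order_gt0 p0] := eqVneq p diagram0; first by [].
by rewrite gtn_eqF.
Qed.

Lemma bullet_eq0 p q : (bullet p q == diagram0) = (p == diagram0) && (q == diagram0).
Proof. by rewrite -!diag_order_eq0 diag_order_bullet addn_eq0. Qed.

(** For non-empty diagrams both sides impose the same conditions on a predicate: one for each of the
    three diagrams and one for each of the two seams. *)
Lemma bulletA : associative bullet.
Proof.
move=> p q r.
have [->|p0] := eqVneq p diagram0; first by rewrite !bullet0p.
have [->|q0] := eqVneq q diagram0; first by rewrite bulletp0 bullet0p.
have [->|r0] := eqVneq r diagram0; first by rewrite !bulletp0.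
have pq0 : bullet p q != diagram0 by rewrite bullet_eq0 negb_and p0.
have qr0 : bullet q r != diagram0 by rewrite bullet_eq0 negb_and q0.
apply: diagram_ext => [|S]; first by rewrite !diag_order_bullet addnA.
rewrite (propext (saturated_bullet _ p0 qr0)) (propext (saturated_bullet _ pq0 r0)).
rewrite (propext (saturated_bullet _ q0 r0)) (propext (saturated_bullet _ p0 q0)).
rewrite diag_order_bullet /shift_label /=.
have shE : (fun v : nat * bool => S ((v.1 + (diag_order p + diag_order q))%N, v.2)) =
    (fun v => S ((v.1 + diag_order q + diag_order p)%N, v.2)).
  by apply/funext => v; rewrite -addnA [(diag_order q + _)%N]addnC.
rewrite shE addSn [(diag_order q + _)%N]addnC.
by split=> [[? [? ? ?] ?]|[[? ? ?] ? ?]].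
Qed.

(** A predicate on the labels of one factor extends to the product by being true on the other
    factor, so the product determines the saturated predicates of each factor. *)
Lemma otimes_cancel p q p' q' : diag_order p = diag_order p' ->
  otimes p q = otimes p' q' -> p = p' /\ q = q'.
Proof.
move=> pp' e.
have qq' : diag_order q = diag_order q'.
  by apply: (@addnI (diag_order p)); rewrite {2}pp' -!diag_order_otimes e.
have satE S : saturated (blocks p) S /\
    saturated (blocks q) (fun v => S (shift_label (diag_order p) v)) <->
    saturated (blocks p') S /\
    saturated (blocks q') (fun v => S (shift_label (diag_order p) v)).
  by rewrite -saturated_otimes e saturated_otimes pp'.
have eqS r (S T : nat * bool -> Prop) :
    (forall v, (0 < v.1 <= diag_order r)%N -> S v <-> T v) ->
    saturated (blocks r) S <-> saturated (blocks r) T.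
  move=> ST; split=> h A v w Ar vA wA.
    by rewrite -!ST ?(block_label Ar) //; exact: (h A).
  by rewrite !ST ?(block_label Ar) //; exact: (h A).
have satT r : saturated (blocks r) (fun=> True) by move=> A v w.
split; apply: diagram_ext => // S.
  (* [T] agrees with [S] on the labels of [p] and holds on all shifted labels of [q]. *)
  pose T v := (v.1 <= diag_order p)%N -> S v.
  have T_p r : diag_order r = diag_order p ->
      saturated (blocks r) S <-> saturated (blocks r) T.
    move=> rp; apply: eqS => v; rewrite rp /T => /andP[_ vp].
    by split=> [|/(_ vp)].
  have T_q r : saturated (blocks r) (fun v => T (shift_label (diag_order p) v)).
    apply/(eqS r _ (fun=> True)) => // v /andP[v0 _]; split=> // _.
    by rewrite /T /= -[leqRHS]add0n leq_add2r leqNgt v0.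
  by rewrite (T_p p) // (T_p p') //; have [h1 h2] := satE T; split=> h;
    [case: h1|case: h2].
(* Here [T] holds on the labels of [p] and restricts to [S] on those of [q]. *)
pose T v := (diag_order p < v.1)%N -> S ((v.1 - diag_order p)%N, v.2).
have T_p r : diag_order r = diag_order p -> saturated (blocks r) T.
  move=> rp; apply/(eqS r _ (fun=> True)) => // v; rewrite rp => /andP[_ vp].
  by split=> // _; rewrite /T ltnNge vp.
have T_q r : saturated (blocks r) S <->
    saturated (blocks r) (fun v => T (shift_label (diag_order p) v)).
  apply: eqS => -[i b] /andP[v0 _]; rewrite /T /= addnK.
  by rewrite -[X in (X < _)%N]add0n ltn_add2r v0; split=> // /(_ isT).
by rewrite (T_q q) (T_q q'); have [h1 h2] := satE T; split=> h;
    [case: h1|case: h2] => //; split=> //; apply: T_p.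
Qed.

(** Since no block crosses level [j], the blocks below it form the left factor and the blocks above
    it, shifted down, the right factor. *)
Lemma otimes_cut p j : (j <= diag_order p)%N ->
  saturated (blocks p) (fun v => (v.1 <= j)%N) ->
  exists q r, p = otimes q r /\ diag_order q = j.
Proof.
move=> jp cut.
have /is_diagramP[cov triv ne] := diagram_axioms p.
pose low (A : {fset nat * bool}) := `[< forall v, v \in A -> (v.1 <= j)%N >].
have lowE A v : A \in blocks p -> v \in A -> low A = (v.1 <= j)%N.
  move=> Ap vA; apply/asboolP/idP => [|vj w wA]; first exact.
  exact: (cut A v).
(* The subtraction is truncated, so [unshift] is inverted by the shift only above level [j]; it is
   applied to blocks that are not low. *)
pose unshift (v : nat * bool) := ((v.1 - j)%N, v.2).
have unshiftK v : (j < v.1)%N -> shift_label j (unshift v) = v.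
  by case: v => i b /= ji; rewrite /shift_label /= subnK // ltnW.
have shiftK v : unshift (shift_label j v) = v.
  by case: v => i b; rewrite /unshift /= addnK.
pose Q := [fset A in blocks p | low A]%fset.
pose unshift_block (A : {fset nat * bool}) := [fset unshift v | v in A]%fset.
pose R := [fset unshift_block A | A in [fset A in blocks p | ~~ low A]]%fset.
have inQ (A : {fset nat * bool}) : (A \in Q) = (A \in blocks p) && low A by rewrite !inE.
have inR (B : {fset nat * bool}) : B \in R -> exists2 A, A \in blocks p & ~~ low A /\
    B = unshift_block A.
  by move=> /imfsetP[A /=]; rewrite !inE /= => /andP[Ap lA] ->; exists A.
have Rin (A : {fset nat * bool}) : A \in blocks p -> ~~ low A -> unshift_block A \in R.
  by move=> Ap lA; apply/imfsetP; exists A => //; rewrite !inE /= Ap.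
have dQ : is_diagram (j, Q).
  apply/is_diagramP; split=> [v|A B v|A].
  - split=> [/andP[v0 vj]|[A]]; last first.
      by rewrite inQ => /andP[Ap lA] vA; rewrite -(lowE A) // lA (andP (block_label Ap vA)).1.
    have [|A Ap vA] := (cov v).1; first by rewrite v0 (leq_trans vj).
    by exists A; rewrite // inQ Ap (lowE A v).
  - by rewrite !inQ => /andP[Ap _] /andP[Bp _]; exact: triv.
  - by rewrite inQ => /andP[/ne].
have dR : is_diagram ((diag_order p - j)%N, R).
  apply/is_diagramP; split=> [v|A B v|A].
  - split=> [/andP[v0 vj]|[_ /inR[A Ap [lA ->]] /imfsetP[w /= wA ->]]]; last first.
      move: lA; rewrite (lowE A w) // -ltnNge => jw; rewrite /= subn_gt0 jw /=.
      by rewrite leq_sub2r // (andP (block_label Ap wA)).2.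
    have [|A Ap vA] := (cov (shift_label j v)).1.
      by rewrite /= addn_gt0 v0 /= addnC -leq_subRL.
    exists (unshift_block A).
      apply: Rin => //; rewrite (lowE A (shift_label j v)) //= -ltnNge.
      by rewrite -[X in (X < _)%N]add0n ltn_add2r.
    by apply/imfsetP; exists (shift_label j v) => //; rewrite shiftK.
  - move=> /inR[A' A'p [lA ->]] /inR[B' B'p [lB ->]].
    move=> /imfsetP[x /= xA ->] /imfsetP[y /= yB] xy.
    have {}xy : x = y.
      rewrite -(unshiftK x) ?xy ?unshiftK // ltnNge.
        by rewrite -(lowE B').
      by rewrite -(lowE A').
    by rewrite (triv A' B' x) // xy.
  - by move=> /inR[B /ne[v vB] [_ ->]]; exists (unshift v); apply/imfsetP; exists v.
exists (Diagram dQ), (Diagram dR); split=> //.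
apply: diagram_ext => [|S]; first by rewrite diag_order_otimes /= /diag_order /= subnKC.
rewrite saturated_otimes /=; split=> [h|[hQ hR] A v w Ap vA wA].
  split=> [A v w|A v w]; first by rewrite inQ => /andP[Ap _]; exact: h.
  move=> /inR[B Bp [lB ->]] /imfsetP[x /= xB ->] /imfsetP[y /= yB ->].
  rewrite /diag_order /= !unshiftK; first exact: (h B).
    by rewrite ltnNge -(lowE B).
  by rewrite ltnNge -(lowE B).
have [lA|lA] := boolP (low A); first by apply: (hQ A); rewrite // inQ Ap.
have := hR _ (unshift v) (unshift w) (Rin A Ap lA).
rewrite /diag_order /= !unshiftK ?ltnNge -?(lowE A) //.
by apply; apply/imfsetP; [exists v|exists w].
Qed.

Lemma saturated_otimes_leq p q :
  saturated (blocks (otimes p q)) (fun v => (v.1 <= diag_order p)%N).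
Proof.
apply/saturated_otimes; split=> [A v w Ap _ wA _|A v w Aq vA _ /=].
  by case/andP: (block_label Ap wA).
have /andP[v0 _] := block_label Aq vA.
by rewrite -[leqRHS]add0n leq_add2r leqNgt v0.
Qed.

Lemma otimes_irreducible_cut p j : otimes_irreducible p ->
  (0 < j < diag_order p)%N -> ~ saturated (blocks p) (fun v => (v.1 <= j)%N).
Proof.
move=> pI /andP[j0 jp] /(otimes_cut (ltnW jp))[q [r [pE qj]]].
move: j0 jp; rewrite -qj pE diag_order_otimes.
have [->|->] := pI _ _ pE; first by [].
by rewrite addn0 ltnn.
Qed.

(** A factorization would give an uncrossed level. Strictly inside [p] or [q] that level would cut
    an irreducible diagram. *)
Lemma otimes_irreducible_bullet p q : p != diagram0 -> q != diagram0 ->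
  otimes_irreducible p -> otimes_irreducible q -> otimes_irreducible (bullet p q).
Proof.
move=> p0 q0 pI qI a b pqE.
have [->|/diag_order_gt0 a0] := eqVneq a diagram0; first by left.
have [->|/diag_order_gt0 b0] := eqVneq b diagram0; first by right.
have := saturated_otimes_leq (p := a) (q := b); rewrite -pqE.
have ab : (diag_order a < diag_order p + diag_order q)%N.
  by rewrite -diag_order_bullet pqE diag_order_otimes -[X in (X < _)%N]addn0 ltn_add2l.
move=> /(saturated_bullet _ p0 q0)[/= cp cq cut].
have [ap|pa|ap] := ltngtP (diag_order a) (diag_order p).
- by case: (otimes_irreducible_cut (j := diag_order a) pI); rewrite ?a0.
- case: (otimes_irreducible_cut (j := (diag_order a - diag_order p)%N) qI).
    by rewrite subn_gt0 pa ltn_subLR // ltnW.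
  by move=> A v w Aq vA wA; rewrite !leq_subRL ?(ltnW pa) // ![(diag_order p + _)%N]addnC;
    exact: (cq A).
(* At the seam the merged block contains labels on both sides of the level. *)
- by move: cut.1; rewrite ap leqnn ltnn => /(_ isT).
Qed.

(** Levi's lemma: the level [diag_order p] is uncrossed in the common product, hence also in [p'],
    which can be cut there. *)
Lemma otimes_levi p q p' q' : (diag_order p <= diag_order p')%N ->
  otimes p q = otimes p' q' -> exists r, p' = otimes p r /\ q = otimes r q'.
Proof.
move=> pp' e; have := saturated_otimes_leq (p := p) (q := q).
rewrite e => /saturated_otimes[/(otimes_cut pp')[a [r [p'E ap]]] _].
move: e; rewrite p'E -otimesA => /(otimes_cancel (esym ap))[-> ->].
by exists r.
Qed.

(** By Levi's lemma the first factor of smaller order divides the other on the left. Irreducibility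
    makes them equal, and they cancel. *)
Lemma factorization_unique s t :
  (forall p, p \in s -> p != diagram0 /\ otimes_irreducible p) ->
  (forall p, p \in t -> p != diagram0 /\ otimes_irreducible p) ->
  otimes_seq s = otimes_seq t -> s = t.
Proof.
have nil0 p u : p != diagram0 -> otimes_seq (p :: u) <> diagram0.
  move=> /diag_order_gt0 p0 /(congr1 diag_order); rewrite /= diag_order_otimes.
  by case: (diag_order p) p0.
elim: s t => [|p s IH] [|q t] // hs ht.
- by move=> /esym /nil0; case: (ht q (mem_head _ _)) => q0 _ /(_ q0).
- by move=> /nil0; case: (hs p (mem_head _ _)) => p0 _ /(_ p0).
have [[p0 pI] [q0 qI]] := (hs p (mem_head _ _), ht q (mem_head _ _)).
move=> /= e; have pq : p = q.
  have [/otimes_levi /(_ e)[r [qE _]]|/ltnW/otimes_levi /(_ (esym e))[r [pE _]]] :=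
      leqP (diag_order p) (diag_order q).
    by have h := qI _ _ qE; case: h qE p0 => ->; rewrite ?eqxx // otimesp0 => ->.
  by have h := pI _ _ pE; case: h pE q0 => ->; rewrite ?eqxx // otimesp0 => ->.
have [_ e'] := otimes_cancel (congr1 diag_order pq) e.
rewrite pq (IH t) // => [r rs|r rt].
  by apply: hs; rewrite in_cons rs orbT.
by apply: ht; rewrite in_cons rt orbT.
Qed.

End Diagrams.

(** * Words as coordinates for diagrams, and index sets enumerated by lists *)

Lemma mem_splits (T : eqType) (w : seq T) xy :
  (xy \in splits w) = (xy.1 ++ xy.2 == w).
Proof.
case: xy => x y /=; elim: w x y => [|a w IH] [|b x] y; rewrite ?splits_cons in_cons.
- by rewrite orbF xpair_eqE.
- by rewrite xpair_eqE.
- by rewrite xpair_eqE /=; case: eqP => //= _; apply/negP => /mapP[].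
rewrite xpair_eqE eqseq_cons /=; apply/mapP/andP => [[[z t] zt [-> -> ->]]|[/eqP -> xyw]].
  by rewrite eqxx -IH.
by exists (x, y); rewrite ?IH.
Qed.

(** The coproduct sums over a set, so its enumeration must not repeat a splitting. *)
Lemma uniq_splits (T : eqType) (w : seq T) : uniq (splits w).
Proof.
elim: w => // a w IH; rewrite splits_cons cons_uniq map_inj_uniq ?IH; last by move=> [? ?] [? ?] [-> ->].
by rewrite andbT; apply/negP => /mapP[].
Qed.

Lemma mem_map_cons (T : eqType) (x y : T) s (ss : seq (seq T)) :
  (x :: s \in [seq y :: t | t <- ss]) = (x == y) && (s \in ss).
Proof.
by apply/mapP/andP => [[t tss [-> ->]]|[/eqP -> sss]]; [rewrite eqxx|exists s].
Qed.

Section Words.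

Definition is_letter (p : diagram) : bool :=
  (p != diagram0) && `[< otimes_irreducible p >].

Definition letter := {p : diagram | is_letter p}.

Fact letter_bullet_subproof (a b : letter) : is_letter (bullet (val a) (val b)).
Proof.
have /andP[a0 /asboolP aI] := valP a; have /andP[b0 /asboolP bI] := valP b.
rewrite /is_letter bullet_eq0 negb_and a0 /=.
exact/asboolP/otimes_irreducible_bullet.
Qed.

Definition letter_bullet (a b : letter) : letter :=
  exist (fun p => is_letter p) _ (letter_bullet_subproof a b).

Lemma letter_bulletA : associative letter_bullet.
Proof. by move=> a b c; apply: val_inj; exact: bulletA. Qed.

Definition word_diagram (w : seq letter) : diagram := otimes_seq (map val w).

(** Every factor is a letter, so [pmap insub] only changes the type and drops nothing. *)
Definition diagram_word (p : diagram) : seq letter := pmap insub (factors p).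

Lemma diagram_wordE p : map val (diagram_word p) = factors p.
Proof.
rewrite (pmap_filter (insubK _)); apply/all_filterP/allP => q /factorsP[q0 qI].
by rewrite isSome_insub /is_letter q0; apply/asboolP.
Qed.

Lemma diagram_wordK : cancel diagram_word word_diagram.
Proof. by move=> p; rewrite /word_diagram diagram_wordE factorsK. Qed.

Lemma factors_word w : factors (word_diagram w) = map val w.
Proof.
apply: factorization_unique => [p /factorsP //|p /mapP[a _ ->]|].
  by have /andP[? /asboolP] := valP a.
exact: factorsK.
Qed.

Lemma word_diagramK : cancel word_diagram diagram_word.
Proof. by move=> w; apply: (inj_map val_inj); rewrite diagram_wordE factors_word. Qed.

Lemma word_diagram_cat u v :
  word_diagram (u ++ v) = otimes (word_diagram u) (word_diagram v).
Proof. by rewrite /word_diagram map_cat otimes_seq_cat. Qed.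

Lemma word_diagram_eq0 w : (word_diagram w == diagram0) = (w == [::]).
Proof. by rewrite -[diagram0]/(word_diagram [::]) (can_eq word_diagramK). Qed.

(* The pairs of sequences of product_index, with the empty diagram as padding; *)
(* qshuffle only retains their images under bullet, with multiplicities.      *)
Fixpoint alignments (u : seq letter) : seq letter -> seq (seq (diagram * diagram)) :=
  fix alignments_u v :=
    (if nilp u && nilp v then [:: [::]] else [::]) ++
    (if u is a :: u' then
       [seq (val a, diagram0) :: s | s <- alignments u' v] else [::]) ++
    (if v is b :: v' then
       [seq (diagram0, val b) :: s | s <- alignments_u v'] else [::]) ++
    (if u is a :: u' then if v is b :: v' then
       [seq (val a, val b) :: s | s <- alignments u' v'] else [::] else [::]).

Lemma alignments_cons a u b v :
  alignments (a :: u) (b :: v) =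
  [seq (val a, diagram0) :: s | s <- alignments u (b :: v)] ++
  [seq (diagram0, val b) :: s | s <- alignments (a :: u) v] ++
  [seq (val a, val b) :: s | s <- alignments u v].
Proof. by []. Qed.

Lemma alignments_nil_cons b v :
  alignments [::] (b :: v) = [seq (diagram0, val b) :: s | s <- alignments [::] v].
Proof. by rewrite /= cats0. Qed.

Lemma alignments_cons_nil a u :
  alignments (a :: u) [::] = [seq (val a, diagram0) :: s | s <- alignments u [::]].
Proof. by rewrite /= cats0. Qed.

Arguments alignments : simpl never.

Lemma letter_neq0 (a : letter) : (sval a == diagram0) = false.
Proof. by case/andP: (valP a) => /negPf. Qed.

Lemma mem_alignments u v s :
  (s \in alignments u v) =
  [&& Defs.nonempty (unzip1 s) == map val u, Defs.nonempty (unzip2 s) == map val v &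
      all (fun rt => bullet rt.1 rt.2 != diagram0) s].
Proof.
have nil_notin (T : eqType) (x : T) ss : ([::] \in [seq x :: t | t <- ss]) = false.
  by apply/negP => /mapP[].
elim: s u v => [|[r t] s IH] [|a u] [|b v];
  rewrite ?alignments_cons ?alignments_cons_nil ?alignments_nil_cons
    ?mem_cat ?nil_notin ?mem_map_cons ?xpair_eqE ?IH //= bullet_eq0 /Defs.nonempty /=.
(* The emptiness pattern of the first pair selects one of the sublists of [alignments]; the pair of
   two empty diagrams is excluded by the condition on [bullet]. *)
all: case: (eqVneq r diagram0) => [->|r0]; case: (eqVneq t diagram0) => [->|t0] //=;
  rewrite ?eqseq_cons ?(eq_sym diagram0 (sval _)) ?letter_neq0 //= ?orbF ?andbF //;
  by repeat case: (_ == _); rewrite ?orbF.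
Qed.

(** The sublists are disjoint because their first pairs differ in which component is empty. *)
Lemma uniq_alignments u v : uniq (alignments u v).
Proof.
elim: u v => [|a u IHu].
  elim=> [|b v IHv]; rewrite ?alignments_nil_cons // map_inj_uniq // => s t.
  by case.
have consI (x : diagram * diagram) : injective (cons x) by move=> s t [].
elim=> [|b v IHv]; rewrite ?alignments_cons_nil ?map_inj_uniq // alignments_cons.
rewrite !cat_uniq !map_inj_uniq // IHu IHv IHu /= andbT.
apply/andP; split; apply/hasPn => s.
  rewrite mem_cat => /orP[]/mapP[t _ ->]; rewrite /= mem_map_cons xpair_eqE /=.
    by rewrite eq_sym letter_neq0.
  by rewrite letter_neq0 andbF.
by move=> /mapP[t _ ->]; rewrite /= mem_map_cons xpair_eqE letter_neq0.
Qed.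

(** An equality of lists, since distinct alignments can have the same image and each contributes to
    the product. *)
Lemma alignments_bullet u v :
  [seq [seq bullet rt.1 rt.2 | rt <- s] | s <- alignments u v] =
  [seq map val w | w <- qshuffle letter_bullet u v].
Proof.
have cons_map x y (ss : seq (seq (diagram * diagram))) (ws : seq (seq letter)) c :
    bullet x y = val c ->
    [seq [seq bullet rt.1 rt.2 | rt <- s] | s <- ss] = [seq map val w | w <- ws] ->
    [seq [seq bullet rt.1 rt.2 | rt <- s] | s <- [seq (x, y) :: t | t <- ss]] =
    [seq map val w | w <- [seq c :: w | w <- ws]].
  move=> xyc e; rewrite -!map_comp.
  transitivity [seq val c :: s | s <- [seq [seq bullet rt.1 rt.2 | rt <- s] | s <- ss]].
    by rewrite -map_comp; apply: eq_map => s /=; rewrite xyc.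
  by rewrite e -map_comp.
elim: u v => [|a u IHu].
  elim=> [|b v IHv] //; rewrite alignments_nil_cons qshuffle0s.
  by rewrite (cons_map _ _ _ [:: v] b) ?bullet0p // IHv qshuffle0s.
elim=> [|b v IHv].
  rewrite alignments_cons_nil qshuffles0 (cons_map _ _ _ [:: u] a) ?bulletp0 //.
  by rewrite IHu qshuffles0.
rewrite alignments_cons qshuffle_cons !map_cat; congr (_ ++ (_ ++ _)).
- exact: cons_map (bulletp0 _) (IHu _).
- exact: cons_map (bullet0p _) IHv.
- exact: cons_map (IHu _).
Qed.

Lemma big_product_index (V : nmodType) u v (F : diagram -> V) :
  \sum_(s \in product_index (word_diagram u) (word_diagram v))
    F (otimes_seq [seq bullet rt.1 rt.2 | rt <- s]) =
  \sum_(w <- qshuffle letter_bullet u v) F (word_diagram w).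
Proof.
have -> : product_index (word_diagram u) (word_diagram v) = [set` alignments u v]%classic.
  apply/seteqP; split=> s /=; rewrite /product_index /= mem_alignments !factors_word.
    by case=> -> -> ->; rewrite !eqxx.
  by case/and3P => /eqP -> /eqP -> ->.
rewrite -fsbig_seq ?uniq_alignments //.
transitivity (\sum_(s <- [seq [seq bullet rt.1 rt.2 | rt <- s] | s <- alignments u v])
    F (otimes_seq s)); first by rewrite big_map.
by rewrite alignments_bullet big_map.
Qed.

Lemma big_coproduct_index (V : nmodType) w (F : diagram * diagram -> V) :
  \sum_(pq \in [set pq | otimes pq.1 pq.2 = word_diagram w]%classic) F pq =
  \sum_(xy <- splits w) F (word_diagram xy.1, word_diagram xy.2).
Proof.
pose f (xy : seq letter * seq letter) := (word_diagram xy.1, word_diagram xy.2).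
have fI : injective f.
  by move=> [x y] [z t] [/(can_inj word_diagramK) -> /(can_inj word_diagramK) ->].
have -> : [set pq | otimes pq.1 pq.2 = word_diagram w]%classic =
    [set` [seq f xy | xy <- splits w]]%classic.
  apply/seteqP; split=> -[p q] /=.
    rewrite -(diagram_wordK p) -(diagram_wordK q) -word_diagram_cat.
    move=> /(can_inj word_diagramK) e; apply/mapP.
    by exists (diagram_word p, diagram_word q); rewrite // mem_splits e.
  by move=> /mapP[[x y]]; rewrite mem_splits => /eqP /= <- [-> ->]; rewrite word_diagram_cat.
rewrite -fsbig_seq ?big_map // map_inj_uniq // uniq_splits.
by [].
Qed.

End Words.

(** * Linear maps on tensor products *)

Section LinearMaps.
Variable K : fieldType.
Implicit Types U V W X : lmodType K.

(** The Hopf algebra axioms use linearity as a predicate on plain functions, so the basic facts are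
    stated for the predicate. *)
Lemma linear_prop0 U V (f : U -> V) : linear f -> f 0 = 0.
Proof.
by move=> f_lin; have := f_lin (-1) 0 0; rewrite scaler0 addr0 scaleN1r addNr.
Qed.

Lemma linear_prop_sum U V (f : U -> V) I (r : seq I) (F : I -> U) :
  linear f -> f (\sum_(i <- r) F i) = \sum_(i <- r) f (F i).
Proof.
move=> f_lin; apply: big_morph => [u v|]; last exact: linear_prop0.
by have := f_lin 1 u v; rewrite !scale1r.
Qed.

Lemma linear_prop_comp U V W (f : V -> W) (g : U -> V) :
  linear f -> linear g -> linear (fun u => f (g u)).
Proof. by move=> f_lin g_lin a u v; rewrite g_lin f_lin. Qed.

Lemma lin_ext_linear_fun (B : choiceType) V (f g : B -> V) a (x : {malg K[B]}) :
  lin_ext (fun b => a *: f b + g b) x = a *: lin_ext f x + lin_ext g x.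
Proof.
rewrite /lin_ext scaler_sumr -big_split; apply: eq_bigr => b _.
by rewrite scalerDr !scalerA mulrC.
Qed.

Lemma tlift_linear_fun U V W (f g : U -> V -> W) a t :
  tlift (fun u v => a *: f u v + g u v) t = a *: tlift f t + tlift g t.
Proof. exact: lin_ext_linear_fun. Qed.

(** In [tassoc] and [tmul] the lifted function depends on an outer argument. Linearity in that
    argument holds because [tlift] evaluates on a fixed representative of [t]. *)
Lemma tlift_linear_param U V W X (f : X -> U -> V -> W) t :
  (forall u v, linear (fun x => f x u v)) -> linear (fun x => tlift (f x) t).
Proof.
move=> f_lin a x y; rewrite -tlift_linear_fun; congr tlift.
by apply/funext => u; apply/funext => v; exact: f_lin.
Qed.

Lemma bilinear_comp U V W U' V' (h : U' -> V' -> W) (f : U -> U') (g : V -> V') :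
  bilinear_for *:%R *:%R h -> linear f -> linear g ->
  bilinear_for *:%R *:%R (fun u v => h (f u) (g v)).
Proof.
move=> [h1 h2] f_lin g_lin; split=> [v|u].
  exact: (linear_prop_comp (h1 (g v)) f_lin).
exact: (linear_prop_comp (h2 (f u)) g_lin).
Qed.

Lemma id_linear U : linear (@id U). Proof. by []. Qed.

Lemma tpure_sum U V I J (r : seq I) (s : seq J) (F : I -> U) (G : J -> V) :
  (\sum_(i <- r) F i) \ox (\sum_(j <- s) G j) =
  \sum_(i <- r) \sum_(j <- s) F i \ox G j.
Proof.
have [h1 h2] := @tpure_bilinear K U V.
rewrite (linear_prop_sum _ _ (h1 _)); apply: eq_bigr => i _.
by rewrite (linear_prop_sum _ _ (h2 _)).
Qed.

Lemma tmap_bilinear U V U' V' (f : U -> U') (g : V -> V') :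
  linear f -> linear g -> bilinear_for *:%R *:%R (fun u v => f u \ox g v).
Proof. exact: bilinear_comp (@tpure_bilinear K U' V'). Qed.

Lemma tmap_linear U V U' V' (f : U -> U') (g : V -> V') :
  linear f -> linear g -> linear (tmap f g).
Proof. by move=> f_lin g_lin; apply/tlift_linear/tmap_bilinear. Qed.

Lemma tmap_pure U V U' V' (f : U -> U') (g : V -> V') u v :
  linear f -> linear g -> tmap f g (u \ox v) = f u \ox g v.
Proof. by move=> f_lin g_lin; rewrite /tmap tlift_pure //; exact: tmap_bilinear. Qed.

Lemma tassoc_inner_bilinear U V W (w : W) :
  bilinear_for *:%R *:%R (fun (u : U) (v : V) => u \ox (v \ox w)).
Proof.
apply: (bilinear_comp (f := id) (tpure_bilinear U (tensor V W)) _ _) => //.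
exact: (tpure_bilinear V W).1.
Qed.

Lemma tassoc_bilinear U V W : bilinear_for *:%R *:%R
  (fun (t : tensor U V) (w : W) => tlift (fun u v => u \ox (v \ox w)) t).
Proof.
split=> [w|t]; first exact/tlift_linear/tassoc_inner_bilinear.
apply: tlift_linear_param => u v.
exact: (linear_prop_comp ((tpure_bilinear _ _).2 u) ((tpure_bilinear _ _).2 v)).
Qed.

Lemma tassoc_linear U V W : linear (@tassoc K U V W).
Proof. exact/tlift_linear/tassoc_bilinear. Qed.

Lemma tassoc_pure U V W (u : U) (v : V) (w : W) :
  tassoc ((u \ox v) \ox w) = u \ox (v \ox w).
Proof.
rewrite /tassoc tlift_pure; last exact: tassoc_bilinear.
by rewrite tlift_pure //; exact: tassoc_inner_bilinear.
Qed.

Section TensorProduct.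
Variables (H : lmodType K) (mul : H -> H -> H).
Hypothesis mul_bil : bilinear_for *:%R *:%R mul.

Lemma tmul_inner_bilinear a b :
  bilinear_for *:%R *:%R (fun c d => mul a c \ox mul b d).
Proof. by apply: tmap_bilinear; apply: mul_bil.2. Qed.

Lemma tmul_bilinear : bilinear_for *:%R *:%R (tmul mul).
Proof.
have bil y : bilinear_for *:%R *:%R
    (fun a b => tlift (fun c d => mul a c \ox mul b d) y).
  split=> [b|a]; apply: tlift_linear_param => c d.
    exact: (linear_prop_comp ((tpure_bilinear _ _).1 _) (mul_bil.1 c)).
  exact: (linear_prop_comp ((tpure_bilinear _ _).2 _) (mul_bil.1 d)).
split=> [y|x]; first exact/tlift_linear/bil.
apply: tlift_linear_param => a b.
exact/tlift_linear/tmul_inner_bilinear.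
Qed.

Lemma tmul_pure a b c d : tmul mul (a \ox b) (c \ox d) = mul a c \ox mul b d.
Proof.
rewrite /tmul tlift_pure; first by rewrite tlift_pure //; exact: tmul_inner_bilinear.
split=> [v|u]; apply: tlift_linear_param => x y.
  exact: (linear_prop_comp ((tpure_bilinear _ _).1 _) (mul_bil.1 x)).
exact: (linear_prop_comp ((tpure_bilinear _ _).2 _) (mul_bil.1 y)).
Qed.

End TensorProduct.

End LinearMaps.

(** * Convolution inverses on words *)

Section Convolution.
Variables (K : fieldType) (L : eqType) (H : lmodType K).
Variables (mul : H -> H -> H) (one : H).
Hypothesis mul_alg : is_algebra mul one.
Implicit Types (f g h : seq L -> H) (w : seq L).

Let mul_bil : bilinear_for *:%R *:%R mul. Proof. by case: mul_alg. Qed.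
Let mulA : associative mul. Proof. by case: mul_alg. Qed.
Let mul1 : left_id one mul. Proof. by case: mul_alg. Qed.
Let mulr1 : right_id one mul. Proof. by case: mul_alg. Qed.

Definition convolution f g w : H := \sum_(xy <- splits w) mul (f xy.1) (g xy.2).

Definition conv_unit w : H := if w is [::] then one else 0.

Lemma convolutionA f g h w :
  convolution f (convolution g h) w = convolution (convolution f g) h w.
Proof.
rewrite /convolution.
under eq_bigr do rewrite (linear_prop_sum _ _ (mul_bil.2 _)).
under [RHS]eq_bigr do rewrite (linear_prop_sum _ _ (mul_bil.1 _)).
rewrite (splitsA w (fun s t r => mul (mul (f s) (g t)) (h r))).
by do 2!apply: eq_bigr => ? _; rewrite mulA.
Qed.

Lemma convolution1f f w : convolution conv_unit f w = f w.
Proof.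
case: w => [|a w]; first by rewrite /convolution big_splits_nil mul1.
rewrite /convolution big_splits_cons /= mul1 big1 ?addr0 // => xy _.
exact: linear_prop0 (mul_bil.1 _).
Qed.

Lemma convolutionf1 f w : convolution f conv_unit w = f w.
Proof.
rewrite /convolution; elim: w f => [|a w IH] f.
  by rewrite big_splits_nil mulr1.
rewrite big_splits_cons /= (linear_prop0 (mul_bil.2 _)) add0r.
(* The letter [a] stays in the left piece, so [f] changes along the induction. *)
exact: (IH (f \o cons a)).
Qed.

Lemma eq_convolution f g f' g' w : f =1 f' -> g =1 g' ->
  convolution f g w = convolution f' g' w.
Proof. by move=> ff' gg'; apply: eq_bigr => xy _; rewrite ff' gg'. Qed.

(* The fuel n bounds the recursion; any n > size w gives the same value. *)
Fixpoint conv_inverse_fuel f (n : nat) w : H :=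
  if n is n'.+1 then
    if w is a :: w' then
      - \sum_(xy <- splits w') mul (f (a :: xy.1)) (conv_inverse_fuel f n' xy.2)
    else one
  else 0.

Definition conv_inverse f w : H := conv_inverse_fuel f (size w).+1 w.

Lemma conv_inverse_fuel_cons f n a w : conv_inverse_fuel f n.+1 (a :: w) =
  - \sum_(xy <- splits w) mul (f (a :: xy.1)) (conv_inverse_fuel f n xy.2).
Proof. by []. Qed.

Lemma conv_inverse_fuelE f n w :
  (size w < n)%N -> conv_inverse_fuel f n w = conv_inverse f w.
Proof.
rewrite /conv_inverse.
have [m] := ubnP (size w).+1; move: m.
(* Any two sufficient amounts of fuel agree; the symmetric form is the one that passes through the
   recursion. *)
suff aux m k t : (size t < k)%N -> (size t < m)%N ->
    conv_inverse_fuel f k t = conv_inverse_fuel f m t by move=> m _ wn; exact: aux.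
elim: m k t => [|m IH] k t; first by rewrite ltn0.
case: k => [|k]; first by rewrite ltn0.
case: t => [|a t] tk tm; first by [].
rewrite !conv_inverse_fuel_cons; congr (- _); apply: eq_big_seq => xy; rewrite mem_splits => /eqP t_xy.
have xyt : (size xy.2 <= size t)%N by rewrite -t_xy size_cat leq_addl.
by congr mul; apply: IH; exact: leq_ltn_trans xyt _.
Qed.

(** When [f [::] = one], this solves the vanishing of the convolution of [f] and its inverse at
    [a :: w] for the term with empty left piece. *)
Lemma conv_inverse_cons f a w : conv_inverse f (a :: w) =
  - \sum_(xy <- splits w) mul (f (a :: xy.1)) (conv_inverse f xy.2).
Proof.
rewrite /conv_inverse conv_inverse_fuel_cons; congr (- _).
apply: eq_big_seq => xy; rewrite mem_splits => /eqP w_xy.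
by congr mul; apply: conv_inverse_fuelE; rewrite /= ltnS -w_xy size_cat leq_addl.
Qed.

Lemma convolution_conv_inverse f w : f [::] = one ->
  convolution f (conv_inverse f) w = conv_unit w.
Proof.
move=> f1; rewrite /convolution; case: w => [|a w].
  by rewrite big_splits_nil f1 mul1.
by rewrite big_splits_cons /= f1 mul1 conv_inverse_cons addNr.
Qed.

(* If f * g = 1 and g * h = 1 then f = f * (g * h) = h. *)
Lemma conv_inverse_convolution f w : f [::] = one ->
  convolution (conv_inverse f) f w = conv_unit w.
Proof.
move=> f1; set g := conv_inverse f; set h := conv_inverse g.
have gh : convolution g h =1 conv_unit by move=> t; exact: convolution_conv_inverse.
have fh : f =1 h.
  move=> t; rewrite -(convolutionf1 f) -(eq_convolution _ (frefl f) gh) convolutionA.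
  rewrite -[RHS]convolution1f; apply: eq_convolution => // s.
  exact: convolution_conv_inverse.
by rewrite (eq_convolution _ (frefl g) fh) gh.
Qed.

End Convolution.

(** * The Hopf algebra ParQSym *)

Section HopfStructure.
Variable K : fieldType.
Local Notation A := (parqsym K).
Local Notation mul := (@parqsym_mul K).
Local Notation comul := (@parqsym_comul K).
Local Notation counit := (@parqsym_counit K).
Local Notation qsh := (qshuffle letter_bullet).
Implicit Types (V : lmodType K) (u v w : seq letter) (x y z : A).

Definition Mword w : A := Mpar K (word_diagram w).

Definition lin_word V (f : seq letter -> V) (x : A) : V :=
  lin_ext (fun p => f (diagram_word p)) x.

Lemma lin_word_linear V (f : seq letter -> V) : linear (lin_word f).
Proof. exact: lin_ext_linear. Qed.

Lemma lin_wordE V (f : seq letter -> V) w : lin_word f (Mword w) = f w.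
Proof. by rewrite /lin_word lin_ext_basis word_diagramK. Qed.

Lemma parqsym_ind (P : A -> Prop) : subspace P -> (forall w, P (Mword w)) -> forall x, P x.
Proof.
move=> [P0 PD] PM x; rewrite [x]monalgE.
apply: (big_ind P) => // [y z Py Pz|p _]; first by rewrite -[y]scale1r; apply: PD.
have -> : << x@_p *g p >> = x@_p *: << p >> + 0 :> A.
  by rewrite addr0; apply/malgP => q; rewrite mcoeffZ !mcoeffU mulr_natr.
by apply: PD => //; rewrite -(diagram_wordK p); exact: PM.
Qed.

Lemma parqsym_ext V (f g : A -> V) : linear f -> linear g ->
  (forall w, f (Mword w) = g (Mword w)) -> forall x, f x = g x.
Proof.
move=> f_lin g_lin fg; apply: parqsym_ind => //; split=> [|a x y fgx fgy].
  by rewrite !linear_prop0.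
by rewrite f_lin g_lin fgx fgy.
Qed.

Lemma mul_bilinear : bilinear_for *:%R *:%R mul.
Proof.
split=> [y|x]; first exact: lin_ext_linear.
move=> a y z; rewrite /parqsym_mul -lin_ext_linear_fun; congr lin_ext.
by apply/funext => p; exact: lin_ext_linear.
Qed.

Let mull x : linear (mul^~ x) := mul_bilinear.1 x.
Let mulr x : linear (mul x) := mul_bilinear.2 x.

Lemma Mword_mul u v : mul (Mword u) (Mword v) = \sum_(w <- qsh u v) Mword w.
Proof.
rewrite /parqsym_mul !lin_ext_basis /Mpar_mul !word_diagram_eq0.
case: eqP => [->|u0]; first by rewrite big_qshuffle0s.
case: eqP => [->|v0]; first by rewrite big_qshuffles0.
exact: (big_product_index u v (@Mpar K)).
Qed.

Lemma Mword_comul w :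
  comul (Mword w) = \sum_(xy <- splits w) Mword xy.1 \ox Mword xy.2.
Proof.
rewrite /parqsym_comul lin_ext_basis.
exact: (big_coproduct_index w (fun pq => Mpar K pq.1 \ox Mpar K pq.2)).
Qed.

Lemma Mword_counit w : counit (Mword w) = (w == [::])%:R.
Proof. by rewrite /parqsym_counit lin_ext_basis word_diagram_eq0. Qed.

Lemma comul_linear : linear comul.
Proof. exact: lin_ext_linear. Qed.

Lemma counit_linear : linear (counit : A -> K^o).
Proof. exact: lin_ext_linear. Qed.

Lemma parqsym_mulA : associative mul.
Proof.
move=> x y z; move: x; apply: parqsym_ext => [||u].
- exact: mull.
- exact: (linear_prop_comp (mull z) (mull y)).
move: y; apply: parqsym_ext => [||v].
- exact: (linear_prop_comp (mulr _) (mull z)).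
- exact: (linear_prop_comp (mull z) (mulr _)).
move: z; apply: parqsym_ext => [||w].
- exact: (linear_prop_comp (mulr _) (mulr _)).
- exact: mulr.
rewrite !Mword_mul (linear_prop_sum _ _ (mulr _)) (linear_prop_sum _ _ (mull _)).
under eq_bigr do rewrite Mword_mul.
under [RHS]eq_bigr do rewrite Mword_mul.
by rewrite (qshuffleA letter_bulletA).
Qed.

Lemma Mword_mul1 w : mul (Mword [::]) (Mword w) = Mword w.
Proof. by rewrite Mword_mul big_qshuffle0s. Qed.

Lemma Mword_mulr1 w : mul (Mword w) (Mword [::]) = Mword w.
Proof. by rewrite Mword_mul big_qshuffles0. Qed.

Lemma parqsym_mul1 : left_id (Mword [::]) mul.
Proof. by apply: parqsym_ext => [||w]; [exact: mulr|exact: id_linear|exact: Mword_mul1]. Qed.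

Lemma parqsym_mulr1 : right_id (Mword [::]) mul.
Proof. by apply: parqsym_ext => [||w]; [exact: mull|exact: id_linear|exact: Mword_mulr1]. Qed.

Lemma parqsym_is_algebra : is_algebra mul (Mpar K diagram0).
Proof.
split; [exact: mul_bilinear|exact: parqsym_mulA|exact: parqsym_mul1|exact: parqsym_mulr1].
Qed.

Lemma counit_scale_bilinear :
  bilinear_for *:%R *:%R (fun x y => counit x *: y).
Proof.
split=> [y a x z|x a y z] /=.
  by rewrite counit_linear scalerDl scalerA.
by rewrite scalerDr !scalerA mulrC.
Qed.

Lemma counit_scale_bilinear_r :
  bilinear_for *:%R *:%R (fun x y => counit y *: x).
Proof. by split=> [y|x]; [exact: counit_scale_bilinear.2|exact: counit_scale_bilinear.1]. Qed.

Lemma parqsym_is_coalgebra : is_coalgebra comul counit.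
Proof.
have mapl := tmap_linear comul_linear (@id_linear K A).
have mapr := tmap_linear (@id_linear K A) comul_linear.
split.
- exact: comul_linear.
- exact: counit_linear.
- apply: parqsym_ext => [||w].
  + exact: (linear_prop_comp (@tassoc_linear _ _ _ _) (linear_prop_comp mapl comul_linear)).
  + exact: (linear_prop_comp mapr comul_linear).
  rewrite Mword_comul (linear_prop_sum _ _ mapl) (linear_prop_sum _ _ mapr).
  rewrite (linear_prop_sum _ _ (@tassoc_linear _ _ _ _)).
  transitivity (\sum_(xy <- splits w) \sum_(zt <- splits xy.1)
      Mword zt.1 \ox (Mword zt.2 \ox Mword xy.2)).
    apply: eq_bigr => xy _; rewrite tmap_pure //; last exact: comul_linear.
    rewrite Mword_comul (linear_prop_sum _ _ ((tpure_bilinear _ _).1 _)).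
    rewrite (linear_prop_sum _ _ (@tassoc_linear _ _ _ _)).
    by apply: eq_bigr => zt _; rewrite tassoc_pure.
  rewrite (splitsA w (fun u v t => Mword u \ox (Mword v \ox Mword t))).
  apply: eq_bigr => xy _; rewrite tmap_pure //; last exact: comul_linear.
  by rewrite Mword_comul (linear_prop_sum _ _ ((tpure_bilinear _ _).2 _)).
- apply: parqsym_ext => [||w]; last 1 first.
  + rewrite Mword_comul (linear_prop_sum _ _ (tlift_linear counit_scale_bilinear)).
    under eq_bigr do rewrite (tlift_pure counit_scale_bilinear) Mword_counit.
    case: w => [|a w]; first by rewrite big_splits_nil scale1r.
    rewrite big_splits_cons /= scale1r big1 ?addr0 // => xy _.
    by rewrite scale0r.
  + exact: (linear_prop_comp (tlift_linear counit_scale_bilinear) comul_linear).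
  + exact: id_linear.
- apply: parqsym_ext => [||w]; last 1 first.
  + rewrite Mword_comul (linear_prop_sum _ _ (tlift_linear counit_scale_bilinear_r)).
    under eq_bigr do rewrite (tlift_pure counit_scale_bilinear_r) Mword_counit.
    (* Only the splitting with empty right piece survives. It is the last one, so the induction has
       to generalize over [f]. *)
    have sumE (f : seq letter -> A) :
        \sum_(xy <- splits w) (xy.2 == [::])%:R *: f xy.1 = f w.
      elim: w f => [|a w IH] f; first by rewrite big_splits_nil scale1r.
      by rewrite big_splits_cons /= scale0r add0r (IH (f \o cons a)).
    exact: sumE.
  + exact: (linear_prop_comp (tlift_linear counit_scale_bilinear_r) comul_linear).
  + exact: id_linear.
Qed.

Lemma comul_mul x y : comul (mul x y) = tmul mul (comul x) (comul y).
Proof.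
have tm := tmul_bilinear mul_bilinear.
move: x; apply: parqsym_ext => [||u].
- exact: (linear_prop_comp comul_linear (mull y)).
- exact: (linear_prop_comp (tm.1 _) comul_linear).
move: y; apply: parqsym_ext => [||v].
- exact: (linear_prop_comp comul_linear (mulr _)).
- exact: (linear_prop_comp (tm.2 _) comul_linear).
rewrite Mword_mul (linear_prop_sum _ _ comul_linear).
under eq_bigr do rewrite Mword_comul.
rewrite (splits_qshuffle _ _ _ (fun s t => Mword s \ox Mword t)).
rewrite !Mword_comul (linear_prop_sum _ _ (tm.1 _)); apply: eq_bigr => p _.
rewrite (linear_prop_sum _ _ (tm.2 _)); apply: eq_bigr => q _.
by rewrite tmul_pure; [rewrite !Mword_mul tpure_sum|exact: mul_bilinear].
Qed.

Lemma counit_mul x y : counit (mul x y) = counit x * counit y.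
Proof.
have lin_l (c : K) : linear (fun x => counit x * c : K^o).
  by move=> a x' y' /=; rewrite counit_linear mulrDl -mulrA.
have lin_r (c : K) : linear (fun x => c * counit x : K^o).
  by move=> a x' y' /=; rewrite counit_linear mulrDr mulrCA.
move: x; apply: (@parqsym_ext K^o) => [||u].
- exact: (linear_prop_comp counit_linear (mull y)).
- exact: lin_l.
move: y; apply: (@parqsym_ext K^o) => [||v].
- exact: (linear_prop_comp counit_linear (mulr _)).
- exact: lin_r.
rewrite Mword_mul (linear_prop_sum _ _ counit_linear) !Mword_counit.
case: u => [|a u]; first by rewrite big_qshuffle0s Mword_counit mul1r.
(* A quasi-shuffle with a non-empty word is non-empty, so every counit in the sum vanishes. *)
rewrite mul0r big1_seq // => w /andP[_ wuv].
rewrite Mword_counit; have /allP/(_ w wuv) := qshuffle_nonnil letter_bullet a u v.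
by case: w {wuv}.
Qed.

Lemma parqsym_is_bialgebra : is_bialgebra (ParQSym K).
Proof.
split.
- exact: parqsym_is_algebra.
- exact: parqsym_is_coalgebra.
- split; last exact: comul_mul.
  by rewrite /= -[Mpar K diagram0]/(Mword [::]) Mword_comul big_splits_nil.
- split; last exact: counit_mul.
  by rewrite /= -[Mpar K diagram0]/(Mword [::]) Mword_counit.
Qed.

(** The antipode is the convolution inverse of the identity map, which on words is [Mword]. *)
Definition parqsym_antipode : A -> A := lin_word (conv_inverse mul (Mword [::]) Mword).

Lemma antipode_linear : linear parqsym_antipode.
Proof. exact: lin_word_linear. Qed.

Lemma conv_unitE w : conv_unit (Mword [::]) w = counit (Mword w) *: Mword [::].
Proof. by rewrite Mword_counit; case: w => [|a w] /=; rewrite ?scale1r ?scale0r. Qed.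

Lemma parqsym_antipodeP : is_antipode (ParQSym K) parqsym_antipode.
Proof.
have bilS1 : bilinear_for *:%R *:%R (fun x y => mul (parqsym_antipode x) y).
  exact: (bilinear_comp mul_bilinear antipode_linear (@id_linear K A)).
have bilS2 : bilinear_for *:%R *:%R (fun x y => mul x (parqsym_antipode y)).
  exact: (bilinear_comp mul_bilinear (@id_linear K A) antipode_linear).
have unit_lin : linear (fun x : A => counit x *: Mword [::]).
  by move=> a x y; rewrite counit_linear scalerDl scalerA.
split; first exact: antipode_linear.
- apply: parqsym_ext => [||w]; last 1 first.
  + rewrite /= Mword_comul (linear_prop_sum _ _ (tlift_linear bilS1)).
    under eq_bigr do rewrite (tlift_pure bilS1) /parqsym_antipode lin_wordE.
    by rewrite [LHS](conv_inverse_convolution parqsym_is_algebra (f := Mword)) // conv_unitE.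
  + exact: (linear_prop_comp (tlift_linear bilS1) comul_linear).
  + exact: unit_lin.
- apply: parqsym_ext => [||w]; last 1 first.
  + rewrite /= Mword_comul (linear_prop_sum _ _ (tlift_linear bilS2)).
    under eq_bigr do rewrite (tlift_pure bilS2) /parqsym_antipode lin_wordE.
    by rewrite [LHS](convolution_conv_inverse parqsym_is_algebra (f := Mword)) // conv_unitE.
  + exact: (linear_prop_comp (tlift_linear bilS2) comul_linear).
  + exact: unit_lin.
Qed.

(** * Grading and connectedness *)

Local Notation deg := (@parqsym_deg K).
Local Notation word_order w := (diag_order (word_diagram w)).

(** Reading the degree off the support turns independence of the components and connectedness into
    comparisons of coefficients. *)
Lemma degP n x : deg n x <-> (forall p, x@_p != 0 -> diag_order p = n).
Proof.
split=> [|x_n].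
  move: x; apply: lspan_min; first split=> [p|a x y xn yn p].
  - by rewrite mcoeff0 eqxx.
  - have [x0|/xn //] := eqVneq x@_p 0; have [y0|/yn //] := eqVneq y@_p 0.
    by rewrite mcoeffD mcoeffZ x0 y0 mulr0 addr0 eqxx.
  move=> _ [p pn ->] q; rewrite mcoeffU; case: (eqVneq p q) => [<-//|_].
  by rewrite eqxx.
have [deg0 degD] := lspan_subspace [set x | exists2 p, diag_order p = n & x = Mpar K p]%classic.
rewrite [x]monalgE big_seq; apply: (big_ind (deg n)) => // [y z yn zn|p].
  by rewrite -[y]scale1r; apply: degD.
rewrite -mcoeff_neq0 => /x_n pn.
have -> : << x@_p *g p >> = x@_p *: Mpar K p + 0 :> A.
  by rewrite addr0; apply/malgP => q; rewrite mcoeffZ !mcoeffU mulr_natr.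
by apply: degD => //; apply: sub_lspan; exists p.
Qed.

Lemma deg_subspace n : subspace (deg n).
Proof. exact: lspan_subspace. Qed.

Lemma deg_Mword w : deg (word_order w) (Mword w).
Proof. by apply: sub_lspan; exists (word_diagram w). Qed.

Lemma subspace_sum (U : lmodType K) (P : set U) I (r : seq I) (F : I -> U) (Q : pred I) :
  subspace P -> (forall i, Q i -> P (F i)) -> P (\sum_(i <- r | Q i) F i).
Proof.
move=> [P0 PD] PF; apply: big_ind => // x y Px Py.
by rewrite -[x]scale1r; apply: PD.
Qed.

Lemma deg_ind n (P : set A) : subspace P ->
  (forall w, word_order w = n -> P (Mword w)) -> forall x, deg n x -> P x.
Proof.
move=> Psub PM; apply: lspan_min => // _ [p pn ->].
by rewrite -(diagram_wordK p); apply: PM; rewrite diagram_wordK.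
Qed.

(** With [deg_ind], it reduces preservation of degree by a linear map to a check on words. *)
Lemma subspace_preim (U V : lmodType K) (f : U -> V) (P : set V) :
  linear f -> subspace P -> subspace [set x | P (f x)]%classic.
Proof.
move=> f_lin [P0 PD]; split=> /= [|a x y Px Py]; last by rewrite f_lin; apply: PD.
by rewrite linear_prop0.
Qed.

Lemma parqsym_direct_sum : is_direct_sum (ParQSym K).
Proof.
split=> [n|x|n c c_deg sum0 i i_n] /=; first exact: deg_subspace.
- pose c i : A := \sum_(p <- msupp x | diag_order p == i) << x@_p *g p >>.
  (* The successor is needed because the components are indexed by [i] strictly below the bound. *)
  exists (\max_(p <- msupp x) diag_order p).+1, c; split=> [i|].
    apply: subspace_sum; first exact: deg_subspace.
    move=> p /eqP pi; apply/degP => q; rewrite mcoeffU.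
    by case: (eqVneq p q) => [<-//|_]; rewrite eqxx.
  rewrite [LHS]monalgE /c (exchange_big_dep xpredT) //= big_seq [RHS]big_seq.
  apply: eq_bigr => p px.
  have p_lt : (diag_order p < (\max_(p <- msupp x) diag_order p).+1)%N.
    by rewrite ltnS (big_rem p) //= leq_maxl.
  by rewrite (big_pred1 (Ordinal p_lt)).
- apply/malgP => p; rewrite mcoeff0.
  have [c0|/((degP _ _).1 (c_deg i)) p_i] := eqVneq (c i)@_p 0; first by [].
  (* At [p], whose order is [i], only the component of index [i] can have a non-zero coefficient. *)
  have := congr1 (mcoeff p) sum0; rewrite mcoeff0 raddf_sum /=.
  rewrite (bigD1 (Ordinal i_n)) //= big1 ?addr0 // => j /eqP ji.
  apply: contrapT => /eqP /((degP _ _).1 (c_deg j)) p_j.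
  by apply: ji; apply: val_inj; rewrite /= -p_i p_j.
Qed.

(** Order is additive under both [otimes] and [bullet], so merging letters preserves the total.
    Besides the grading, this serves to exclude empty words in [eta_qshuffle]. *)
Lemma word_order_qshuffle u v w :
  w \in qsh u v -> word_order w = (word_order u + word_order v)%N.
Proof.
have [n] := ubnP (size u + size v)%N.
elim: n u v w => // n IH [|a u] v w uvn; first by rewrite qshuffle0s inE => /eqP ->.
case: v uvn => [|b v] uvn; first by rewrite qshuffles0 inE addn0 => /eqP ->.
rewrite qshuffle_cons !mem_cat => /or3P[] /mapP[t tuv ->];
  rewrite /= !diag_order_otimes (IH _ _ _ _ tuv) /= ?diag_order_bullet ?diag_order_otimes;
  do ?by move: uvn; rewrite /= ?addSn ?addnS !ltnS //; apply: leq_trans;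
    rewrite ?leqnSn.
- by rewrite addnA.
- by rewrite addnCA.
- by rewrite addnACA.
Qed.

Lemma deg_mul i j x y : deg i x -> deg j y -> deg (i + j)%N (mul x y).
Proof.
move=> x_i y_j; move: x x_i.
apply: deg_ind => [|u <-].
  exact: (subspace_preim (f := mul^~ y) (mull y) (deg_subspace _)).
move: y y_j; apply: deg_ind => [|v <-].
  exact: (subspace_preim (f := mul (Mword u)) (mulr _) (deg_subspace _)).
rewrite /= Mword_mul big_seq; apply: subspace_sum => [|w /word_order_qshuffle <-].
  exact: deg_subspace.
exact: deg_Mword.
Qed.

Lemma parqsym_graded : is_graded_bialgebra (ParQSym K).
Proof.
split=> [|||n x|n x n0] /=.
- exact: parqsym_is_bialgebra.
- exact: parqsym_direct_sum.
- split; first exact: (deg_Mword [::]).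
  exact: deg_mul.
- apply: (deg_ind (P := [set x | tensor_deg (ParQSym K) n (comul x)]%classic)) => [|w <-].
    exact: (subspace_preim comul_linear (lspan_subspace _)).
  rewrite /= Mword_comul big_seq; apply: subspace_sum => [|xy]; first exact: lspan_subspace.
  rewrite mem_splits => /eqP <-; apply: sub_lspan.
  exists (word_order xy.1), (word_order xy.2), (Mword xy.1), (Mword xy.2).
  by split=> //; [rewrite word_diagram_cat|exact: deg_Mword|exact: deg_Mword].
- apply: (deg_ind (P := [set x | counit x = 0]%classic)) => [|w wn].
    split=> [|a y z /= y0 z0]; last by rewrite counit_linear y0 z0 scaler0 addr0.
    exact: linear_prop0 counit_linear.
  rewrite /= Mword_counit; case: w wn => // wn.
  by rewrite -wn in n0.
Qed.

Lemma deg_antipode n x : deg n x -> deg n (parqsym_antipode x).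
Proof.
move: x; apply: deg_ind => [|w <-].
  exact: (subspace_preim antipode_linear (deg_subspace _)).
rewrite /= /parqsym_antipode lin_wordE; have [m] := ubnP (size w).
elim: m w => // m IH [|a w] wm; first exact: (deg_Mword [::]).
have [deg0 degD] := deg_subspace (word_order (a :: w)).
rewrite conv_inverse_cons -scaleN1r -[_ *: _]addr0; apply: degD => //.
rewrite big_seq; apply: subspace_sum => [|xy]; first exact: deg_subspace.
rewrite mem_splits => /eqP w_xy; rewrite -w_xy -cat_cons word_diagram_cat.
apply: deg_mul; first exact: deg_Mword.
apply: IH; move: wm; rewrite /= ltnS; apply: leq_trans.
by rewrite ltnS -w_xy size_cat leq_addl.
Qed.

Lemma parqsym_connected : is_connected (ParQSym K).
Proof.
apply/seteqP; split=> x /=.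
  move=> /degP x0; exists x@_diagram0; apply/malgP => p.
  rewrite mcoeffZ mcoeffU mulr_natr.
  have [<-|p0] := eqVneq diagram0 p; first by [].
  apply/eqP; apply: contraTT (p0) => /x0 po; rewrite negbK eq_sym.
  by apply/negPn/negP => /diag_order_gt0; rewrite po.
move=> [c ->]; have [deg0 degD] := deg_subspace 0.
by rewrite -[_ *: _]addr0; apply: degD => //; exact: (deg_Mword [::]).
Qed.

(** * The infinitesimal character on words *)

Definition eta_word w : K :=
  (-1) ^+ (size w).-1 * (last 0%N [seq diag_order (val a) | a <- w])%:R.

Lemma eta_word_cons a w :
  eta_word (a :: w) = if w is [::] then (diag_order (val a))%:R else - eta_word w.
Proof.
by case: w => [|b w] /=; rewrite /eta_word /= ?mul1r // exprS mulN1r mulNr.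
Qed.

Lemma eta_word_cons2 a b w : eta_word [:: a, b & w] = - eta_word (b :: w).
Proof. exact: eta_word_cons. Qed.

Lemma eta_word_nil : eta_word [::] = 0.
Proof. by rewrite /eta_word mulr0. Qed.

Lemma eta_parqsym_Mword w : eta_parqsym (Mword w) = eta_word w.
Proof.
rewrite /eta_parqsym /= /PsiPQ lin_ext_basis eta_Mqsym /eta_weight /= factors_word.
by rewrite -map_comp size_map.
Qed.

(** The two Boolean factors are the counits of [u] and [v], so this is the infinitesimal character
    identity on basis elements. *)
Lemma eta_qshuffle u v : \sum_(w <- qsh u v) eta_word w =
  (u == [::])%:R * eta_word v + eta_word u * (v == [::])%:R.
Proof.
have [n] := ubnP (size u + size v)%N.
elim: n u v => // n IH [|a u] v uvn.
  by rewrite big_qshuffle0s mul1r eta_word_nil mul0r addr0.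
case: v uvn => [|b v] uvn; first by rewrite big_qshuffles0 mul0r add0r mulr1.
(* Prepending [c] changes the sign only of a non-empty word. Hence the case of two empty words,
   where the sum is the order of [c], is left out. *)
have cons_sum c s t : (size s + size t < n)%N -> ~~ (nilp s && nilp t) ->
    \sum_(w <- qsh s t) eta_word (c :: w) =
    - ((s == [::])%:R * eta_word t + eta_word s * (t == [::])%:R).
  move=> st_n st0; rewrite -IH // -sumrN; apply: eq_big_seq => w wst.
  rewrite eta_word_cons; case: w wst => // /word_order_qshuffle /esym/eqP.
  rewrite addn_eq0 !diag_order_eq0 !word_diagram_eq0 => st00.
  by move: st0; rewrite !/(nilp _) !size_eq0 st00.
have a_sum := cons_sum a u (b :: v); have b_sum := cons_sum b (a :: u) v.
rewrite big_qshuffle_cons a_sum ?b_sum ?andbF //; first last.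
  by rewrite -ltnS -addnS.
rewrite !mul0r !mulr0 !addr0 !add0r {a_sum b_sum}.
have uv_n : (size u + size v < n)%N by move: uvn; rewrite /= addSn addnS ltnS => /ltnW.
case: u v {IH uvn} uv_n => [|c u] [|d v] uv_n.
(* Two single letters: the two concatenations contribute minus the orders of [a] and [b], and the
   merged letter contributes their sum. *)
- by rewrite big_qshuffle0s !eta_word_cons /= diag_order_bullet natrD mul1r mulr1 -opprD [X in _ + X]addrC addNr.
(* If exactly one of the tails is empty, one concatenation sum cancels the merged sum by the sign
   rule; if neither is, all three sums vanish. *)
all: rewrite cons_sum //= ?mul1r ?mulr1 ?mul0r ?mulr0 ?addr0 ?add0r.
all: by rewrite ?eta_word_cons2 ?opprK ?oppr0 ?subr0 ?add0r ?addr0 ?subrr.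
Qed.

Lemma eta_parqsym_infinitesimal : infinitesimal_character (ParQSym K) (@eta_parqsym K).
Proof.
have Psi_lin : linear (@PsiPQ K) by exact: lin_ext_linear.
have eta_lin : linear (@eta_parqsym K : A -> K^o).
  exact: (@linear_prop_comp K A (qsym K) K^o (@eta_qsym K) _ (@eta_scalar K) Psi_lin).
have lin_l (c d : K) : linear (fun x => counit x * c + eta_parqsym x * d : K^o).
  move=> a x' y' /=; rewrite counit_linear eta_lin !mulrDl scalerDr -!mulrA.
  by rewrite addrACA.
have lin_r (c d : K) : linear (fun x => c * eta_parqsym x + d * counit x : K^o).
  move=> a x' y' /=; rewrite counit_linear eta_lin !mulrDr scalerDr addrACA.
  by rewrite !(mulrCA _ a).
split=> [|x y] /=; first exact: eta_lin.
move: x; apply: (@parqsym_ext K^o) => [||u].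
- exact: (linear_prop_comp eta_lin (mull y)).
- exact: lin_l.
move: y; apply: (@parqsym_ext K^o) => [||v].
- exact: (linear_prop_comp eta_lin (mulr _)).
- exact: lin_r.
rewrite Mword_mul (linear_prop_sum _ _ eta_lin) !Mword_counit !eta_parqsym_Mword.
under eq_bigr do rewrite eta_parqsym_Mword.
exact: eta_qshuffle.
Qed.

End HopfStructure.

Theorem proposition6p2 (K : fieldType) :
  infinitorial_hopf_algebra (ParQSym K) (@eta_parqsym K).
Proof.
split; last exact: eta_parqsym_infinitesimal.
  split; first exact: parqsym_graded.
  by exists (@parqsym_antipode K); split; [exact: parqsym_antipodeP|exact: deg_antipode].
exact: parqsym_connected.
Qed.
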